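(* Let $E$ be a non-empty cohesive almost zero-dimensional space. Then there is a homeomorphic embedding $\alpha:E\hookrightarrow \mathfrak E_{\mathrm c}$ such that $\alpha(E)$ is dense in $\mathfrak E_{\mathrm c}$ and $\alpha(E)\cup\{\infty\}$ is connected (as a subspace of $\ell^2\cup\{\infty\}$).
   Context: All spaces are separable and metrizable. A subset $A$ of a space $X$ is a C-set in $X$ if $A$ is an intersection of clopen subsets of $X$. A space $X$ is almost zero-dimensional if every point of $X$ has a neighborhood basis consisting of C-sets in $X$. A space $X$ is cohesive if every point $x\in X$ has a neighborhood which contains no non-empty clopen subset of $X$. $\ell^2$ is the Hilbert space of square-summable real sequences with norm $\|\cdot\|$. Complete Erdős space is $\mathfrak E_{\mathrm c}=\{x\in\ell^2: x_i\in\{0\}\cup\{1/n:n=1,2,3,\dots\}\text{ for each } i<\omega\}$ with the $\ell^2$-norm topology. The space $\ell^2\cup\{\infty\}$ is obtained by adding a point $\infty$ whose neighborhoods are the complements (together with $\infty$) of norm-bounded subsets of $\ell^2$. *)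

(* Defs.v *)
From Stdlib Require Import Reals.
Open Scope R_scope.

(** * Metric spaces (all spaces are separable metrizable; we present the
    topology of a space by a compatible metric d). *)

Definition is_metric {X : Type} (d : X -> X -> R) : Prop :=
  (forall x y, 0 <= d x y) /\
  (forall x y, d x y = 0 <-> x = y) /\
  (forall x y, d x y = d y x) /\
  (forall x y z, d x z <= d x y + d y z).

(** separable: there is a countable dense subset (option allows X empty) *)
Definition separable {X : Type} (d : X -> X -> R) : Prop :=
  exists s : nat -> option X,
    forall x eps, 0 < eps -> exists n y, s n = Some y /\ d x y < eps.

Definition is_open {X : Type} (d : X -> X -> R) (U : X -> Prop) : Prop :=
  forall x, U x -> exists eps, 0 < eps /\ forall y, d x y < eps -> U y.

Definition is_closed {X : Type} (d : X -> X -> R) (U : X -> Prop) : Prop :=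
  is_open d (fun x => ~ U x).

Definition is_clopen {X : Type} (d : X -> X -> R) (U : X -> Prop) : Prop :=
  is_open d U /\ is_closed d U.

Definition is_nbhd {X : Type} (d : X -> X -> R) (x : X) (N : X -> Prop) : Prop :=
  exists eps, 0 < eps /\ forall y, d x y < eps -> N y.

Definition is_Cset {X : Type} (d : X -> X -> R) (A : X -> Prop) : Prop :=
  exists F : (X -> Prop) -> Prop,
    (forall C, F C -> is_clopen d C) /\
    (forall x, A x <-> (forall C, F C -> C x)).

Definition almost_zero_dimensional {X : Type} (d : X -> X -> R) : Prop :=
  forall x (U : X -> Prop), is_nbhd d x U ->
    exists A, is_Cset d A /\ is_nbhd d x A /\ (forall y, A y -> U y).

Definition cohesive {X : Type} (d : X -> X -> R) : Prop :=
  forall x, exists N, is_nbhd d x N /\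
    forall C, is_clopen d C -> (forall y, C y -> N y) -> forall y, ~ C y.

Definition has_l2norm (z : nat -> R) (r : R) : Prop :=
  0 <= r /\ infinite_sum (fun i => (z i) ^ 2) (r ^ 2).

Definition in_l2 (z : nat -> R) : Prop := exists r, has_l2norm z r.

Definition vsub (x y : nat -> R) : nat -> R := fun i => x i - y i.

Definition l2dist_lt (x y : nat -> R) (eps : R) : Prop :=
  exists r, has_l2norm (vsub x y) r /\ r < eps.

Definition l2norm_gt (x : nat -> R) (M : R) : Prop :=
  exists r, has_l2norm x r /\ M < r.

Definition in_Ec (x : nat -> R) : Prop :=
  in_l2 x /\
  forall i, x i = 0 \/ exists n : nat, (1 <= n)%nat /\ x i = / INR n.

(** * l^2 ∪ {∞}, modelled as option (nat -> R) with None = ∞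
    (only points Some x with x in l^2 are relevant). *)
Definition open_l2inf (W : option (nat -> R) -> Prop) : Prop :=
  (forall x, in_l2 x -> W (Some x) ->
     exists eps, 0 < eps /\ forall y, in_l2 y -> l2dist_lt y x eps -> W (Some y)) /\
  (W None -> exists M, forall y, in_l2 y -> l2norm_gt y M -> W (Some y)).

Definition connected_l2inf (S : option (nat -> R) -> Prop) : Prop :=
  forall U V, open_l2inf U -> open_l2inf V ->
    (forall p, S p -> U p \/ V p) ->
    (exists p, S p /\ U p) -> (exists p, S p /\ V p) ->
    exists p, S p /\ U p /\ V p.

Definition embedding_into_Ec {X : Type} (d : X -> X -> R) (alpha : X -> nat -> R) : Prop :=
  (forall e, in_Ec (alpha e)) /\
  (forall e e', alpha e = alpha e' -> e = e') /\
  (forall e eps, 0 < eps -> exists delta, 0 < delta /\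
     forall e', d e e' < delta -> l2dist_lt (alpha e') (alpha e) eps) /\
  (forall e eps, 0 < eps -> exists delta, 0 < delta /\
     forall e', l2dist_lt (alpha e') (alpha e) delta -> d e e' < eps).

Definition dense_in_Ec {X : Type} (alpha : X -> nat -> R) : Prop :=
  forall z eps, in_Ec z -> 0 < eps -> exists e, l2dist_lt (alpha e) z eps.

(* Main.v *)
(** Almost zero-dimensionality yields a countable family of clopen sets, hence a
    coarser zero-dimensional topology W, such that every point has a neighborhood
    basis of W-closed sets.  Urysohn's construction with W-closed sets gives a
    continuous, W-lower semicontinuous [phi >= 0] that together with W induces
    the topology; cohesion makes it possible to have [phi] unbounded on every
    non-empty clopen set, so [phi] takes on every clopen set all values above
    its infimum there.

    The coordinates of [alpha] are found by a binary tree of clopen cells.  At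
    each node one question "is the [i]-th coordinate equal to [1/n]?" is asked,
    and the cell is split so that a positive answer raises the infimum of [phi]
    by about [1/n^2] and a negative one by about [0], with summable errors.
    Along a branch the infima converge to [phi], so the squared tail of [alpha]
    is comparable to the amount by which [phi] exceeds the infimum over the
    cell: this gives the embedding.  Both answers are always possible at
    arbitrarily small cost, whence density.  The squared norm of [alpha] bounds
    a multiple of [phi] up to a constant, so it is unbounded on every non-empty
    clopen set, which is connectedness of the image together with infinity.
    Zero coordinates arise only in the limit from infinitely many negative
    answers, as they must: a point with [i]-th coordinate [0] is a limit of
    points with [i]-th coordinate [1/n]. *)

Require Import Defs.
From Stdlib Require Import Reals Lra Lia ZArith List ClassicalEpsilon.
From Stdlib Require Cantor.
Open Scope R_scope.

Lemma functional_choice {A B : Type} (T : A -> B -> Prop) :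
  (forall a, exists b, T a b) -> exists f, forall a, T a (f a).
Proof.
  intros H.
  exists (fun a => proj1_sig (constructive_indefinite_description _ (H a))).
  intros a; apply proj2_sig.
Qed.

(** The clopen sets [B i] generate a topology coarser than that of the space, in
    which the classes of [sim B n] are a neighborhood basis; [wclosed] and [wlsc]
    are closedness and lower semicontinuity for it. *)
Definition sim {X : Type} (B : nat -> X -> Prop) (n : nat) (x y : X) : Prop :=
  forall i, (i < n)%nat -> (B i x <-> B i y).

Definition wclosed {X : Type} (B : nat -> X -> Prop) (A : X -> Prop) : Prop :=
  forall y, ~ A y -> exists n, forall z, sim B n y z -> ~ A z.

Definition wlsc {X : Type} (B : nat -> X -> Prop) (f : X -> R) : Prop :=
  forall x s, s < f x -> exists n, forall y, sim B n x y -> s < f y.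

Definition usc {X : Type} (d : X -> X -> R) (f : X -> R) : Prop :=
  forall x t, f x < t -> is_nbhd d x (fun y => f y < t).

Lemma sim_refl {X} (B : nat -> X -> Prop) n x : sim B n x x.
Proof. intros i _; tauto. Qed.

Lemma sim_sym {X} (B : nat -> X -> Prop) n x y : sim B n x y -> sim B n y x.
Proof. intros H i Hi; specialize (H i Hi); tauto. Qed.

Lemma sim_trans {X} (B : nat -> X -> Prop) n x y z :
  sim B n x y -> sim B n y z -> sim B n x z.
Proof. intros H K i Hi; specialize (H i Hi); specialize (K i Hi); tauto. Qed.

Lemma sim_le {X} (B : nat -> X -> Prop) m n x y :
  (m <= n)%nat -> sim B n x y -> sim B m x y.
Proof. intros Hmn H i Hi; apply H; lia. Qed.

Lemma small_inv (r : R) : 0 < r -> exists k, / INR (S k) < r.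
Proof.
  intros Hr; destruct (archimed_cor1 r Hr) as [N [HN HN0]].
  exists (pred N); rewrite Nat.succ_pred by lia; exact HN.
Qed.

(** * Clopen sets and a countable family generating a coarser topology *)

Section Topology.

Context {X : Type} (d : X -> X -> R) (Hm : is_metric d).

Lemma dist_refl x : d x x = 0.
Proof. apply Hm; reflexivity. Qed.

Lemma dist_sym x y : d x y = d y x.
Proof. apply Hm. Qed.

Lemma dist_tri x y z : d x z <= d x y + d y z.
Proof. apply Hm. Qed.

Lemma nbhd_mem x N : is_nbhd d x N -> N x.
Proof. intros [e [He H]]; apply H; rewrite dist_refl; exact He. Qed.

Lemma nbhd_and x N M :
  is_nbhd d x N -> is_nbhd d x M -> is_nbhd d x (fun y => N y /\ M y).
Proof.
  intros [e [He H]] [f [Hf K]]; exists (Rmin e f); split.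
  - apply Rmin_pos; assumption.
  - intros y Hy; split.
    + apply H; eapply Rlt_le_trans; [exact Hy | apply Rmin_l].
    + apply K; eapply Rlt_le_trans; [exact Hy | apply Rmin_r].
Qed.

Lemma nbhd_imp x (N M : X -> Prop) :
  (forall y, N y -> M y) -> is_nbhd d x N -> is_nbhd d x M.
Proof. intros H [e [He K]]; exists e; split; auto. Qed.

Lemma nbhd_true x : is_nbhd d x (fun _ => True).
Proof. exists 1; split; [lra | trivial]. Qed.

Lemma ball_open z r : is_open d (fun x => d z x < r).
Proof.
  intros x Hx; exists (r - d z x); split; [lra | intros y Hy].
  pose proof (dist_tri z x y); lra.
Qed.

Lemma clopen_and C D :
  is_clopen d C -> is_clopen d D -> is_clopen d (fun x => C x /\ D x).
Proof.
  intros [HC1 HC2] [HD1 HD2]; split.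
  - intros x [Hx Hx']; exact (nbhd_and x C D (HC1 x Hx) (HD1 x Hx')).
  - intros x Hx; destruct (classic (C x)) as [Cx | Cx].
    + apply (nbhd_imp x (fun y => ~ D y)); [tauto |].
      apply (HD2 x); tauto.
    + apply (nbhd_imp x (fun y => ~ C y)); [tauto |].
      apply (HC2 x); tauto.
Qed.

Lemma clopen_not C : is_clopen d C -> is_clopen d (fun x => ~ C x).
Proof.
  intros [HC1 HC2]; split; [exact HC2 |].
  intros x Hx; apply (nbhd_imp x C); [tauto |].
  apply (HC1 x); apply NNPP; exact Hx.
Qed.

Lemma clopen_ext C D :
  (forall x, C x <-> D x) -> is_clopen d C -> is_clopen d D.
Proof.
  intros H [HC1 HC2]; split; intros x Hx.
  - apply (nbhd_imp x C); [apply H | apply (HC1 x); apply H; exact Hx].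
  - apply (nbhd_imp x (fun y => ~ C y)).
    + intros y; rewrite H; trivial.
    + apply (HC2 x); rewrite H; exact Hx.
Qed.

Lemma clopen_true : is_clopen d (fun _ => True).
Proof.
  split; intros x Hx; [apply nbhd_true | destruct (Hx I)].
Qed.

Lemma clopen_or C D :
  is_clopen d C -> is_clopen d D -> is_clopen d (fun x => C x \/ D x).
Proof.
  intros HC HD.
  apply (clopen_ext (fun x => ~ (~ C x /\ ~ D x))); [intros x; tauto |].
  apply clopen_not, clopen_and; apply clopen_not; assumption.
Qed.

Lemma clopen_sim B n x :
  (forall i, is_clopen d (B i)) -> is_clopen d (sim B n x).
Proof.
  intros HB; induction n as [| n IH].
  - apply (clopen_ext (fun _ => True)); [| apply clopen_true].
    intros y; split; [intros _ i Hi; lia | trivial].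
  - assert (HBx : is_clopen d (fun y => B n x <-> B n y)).
    { destruct (classic (B n x)) as [H | H].
      - apply (clopen_ext (B n)); [tauto | apply HB].
      - apply (clopen_ext (fun y => ~ B n y)); [tauto |].
        apply clopen_not, HB. }
    apply (clopen_ext (fun y => sim B n x y /\ (B n x <-> B n y)));
      [| apply clopen_and; assumption].
    intros y; split.
    + intros [H K] i Hi; destruct (Nat.eq_dec i n) as [-> | Hn]; [exact K |].
      apply H; lia.
    + intros H; split; [intros i Hi |]; apply H; lia.
Qed.

Lemma nbhd_sim B n x :
  (forall i, is_clopen d (B i)) -> is_nbhd d x (sim B n x).
Proof.
  intros HB; exact (proj1 (clopen_sim B n x HB) x (sim_refl B n x)).
Qed.

Lemma wlsc_lsc B f x s :
  (forall i, is_clopen d (B i)) -> wlsc B f -> s < f x ->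
  is_nbhd d x (fun y => s < f y).
Proof.
  intros HB Hf Hs; destruct (Hf x s Hs) as [n Hn].
  apply (nbhd_imp x (sim B n x)); [exact Hn | apply nbhd_sim, HB].
Qed.

(** For each pair of basic balls with a C-set between them, one such C-set is kept as a [G n]; for
    each [G n] and basic ball separated by a clopen set, one such clopen set is kept as a [B i]. A
    point off [G n] is missed by a clopen superset of [G n], so some basic ball around it is
    separated from [G n], and the chosen [B i] witnesses w-closedness there. *)
Lemma azd_countable_basis :
  separable d -> almost_zero_dimensional d ->
  exists B G : nat -> X -> Prop,
    (forall i, is_clopen d (B i)) /\
    (forall n, wclosed B (G n)) /\
    (forall x U, is_nbhd d x U ->
       exists n, is_nbhd d x (G n) /\ forall y, G n y -> U y).
Proof.
  intros [s Hs] Hazd.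
  set (ball := fun (u : nat) (x : X) => exists z,
    s (fst (Cantor.of_nat u)) = Some z /\
    d z x < / INR (S (snd (Cantor.of_nat u)))).
  assert (ball_op : forall u, is_open d (ball u)).
  { intros u x [z [Hz Hx]].
    apply (nbhd_imp x (fun y => d z y < / INR (S (snd (Cantor.of_nat u))))).
    - intros y Hy; exists z; auto.
    - exact (ball_open _ _ x Hx). }
  assert (ball_basis : forall x U, is_nbhd d x U ->
            exists u, ball u x /\ forall y, ball u y -> U y).
  { intros x U [e [He HU]].
    destruct (small_inv (e / 2)) as [k Hk]; [lra |].
    assert (Hpos : 0 < / INR (S k)) by (apply Rinv_0_lt_compat, lt_0_INR; lia).
    destruct (Hs x _ Hpos) as [n [z [Hz Hxz]]].
    exists (Cantor.to_nat (n, k)); unfold ball.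
    rewrite Cantor.cancel_of_to; simpl fst; simpl snd; split.
    - exists z; rewrite dist_sym; auto.
    - intros y [z' [Hz' Hy]]; rewrite Hz in Hz'; injection Hz' as <-.
      apply HU; pose proof (dist_tri x z y); lra. }
  destruct (functional_choice (fun (w : nat) (A : X -> Prop) =>
    is_Cset d A /\
    ((exists A', is_Cset d A' /\
        (forall x, ball (fst (Cantor.of_nat w)) x -> A' x) /\
        (forall x, A' x -> ball (snd (Cantor.of_nat w)) x)) ->
     (forall x, ball (fst (Cantor.of_nat w)) x -> A x) /\
     (forall x, A x -> ball (snd (Cantor.of_nat w)) x)))) as [G HG].
  { intros w.
    destruct (classic (exists A', is_Cset d A' /\
        (forall x, ball (fst (Cantor.of_nat w)) x -> A' x) /\
        (forall x, A' x -> ball (snd (Cantor.of_nat w)) x)))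
      as [[A HA] | HA].
    - exists A; tauto.
    (* Default value: the whole space, as the intersection of the empty family. *)
    - exists (fun _ => True); split; [| tauto].
      exists (fun _ => False); split; [tauto |].
      intros x; split; [intros _ C [] | trivial]. }
  destruct (functional_choice (fun (t : nat) (C : X -> Prop) =>
    is_clopen d C /\
    ((exists C', is_clopen d C' /\
        (forall x, G (fst (Cantor.of_nat t)) x -> C' x) /\
        (forall x, ball (snd (Cantor.of_nat t)) x -> ~ C' x)) ->
     (forall x, G (fst (Cantor.of_nat t)) x -> C x) /\
     (forall x, ball (snd (Cantor.of_nat t)) x -> ~ C x)))) as [B HB].
  { intros t.
    destruct (classic (exists C', is_clopen d C' /\
        (forall x, G (fst (Cantor.of_nat t)) x -> C' x) /\
        (forall x, ball (snd (Cantor.of_nat t)) x -> ~ C' x)))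
      as [[C HC] | HC].
    - exists C; tauto.
    - exists (fun _ => True); split; [apply clopen_true | tauto]. }
  exists B, G; split; [| split].
  - intros i; apply HB.
  - intros w y Hy.
    destruct (HG w) as [[F [HF1 HF2]] _].
    assert (Hex : exists C, F C /\ ~ C y).
    { apply NNPP; intros Hn; apply Hy, HF2; intros C HC.
      apply NNPP; intros HCy; apply Hn; exists C; auto. }
    destruct Hex as [C [HC HCy]].
    destruct (ball_basis y (fun z => ~ C z)) as [q [Hq1 Hq2]].
    { exact (proj2 (HF1 C HC) y HCy). }
    destruct (HB (Cantor.to_nat (w, q))) as [_ HB2].
    rewrite Cantor.cancel_of_to in HB2; simpl fst in HB2; simpl snd in HB2.
    destruct HB2 as [HB3 HB4].
    { exists C; split; [apply HF1, HC |]; split; [| exact Hq2].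
      intros x Hx; apply HF2; assumption. }
    (* The successor, because [sim B n] compares the indices strictly below [n]. *)
    exists (S (Cantor.to_nat (w, q))); intros z Hz HGz.
    apply HB3, (Hz _ (Nat.lt_succ_diag_r _)) in HGz.
    exact (HB4 y Hq1 HGz).
  - intros x U HU.
    destruct (ball_basis x U HU) as [v [Hv1 Hv2]].
    destruct (Hazd x (ball v)) as [A [HA1 [HA2 HA3]]].
    { exact (ball_op v x Hv1). }
    destruct (ball_basis x A HA2) as [u [Hu1 Hu2]].
    destruct (HG (Cantor.to_nat (u, v))) as [_ HG2].
    rewrite Cantor.cancel_of_to in HG2; simpl fst in HG2; simpl snd in HG2.
    destruct HG2 as [HG3 HG4]; [exists A; auto |].
    exists (Cantor.to_nat (u, v)); split; [| auto].
    apply (nbhd_imp x (ball u)); [exact HG3 | exact (ball_op u x Hu1)].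
Qed.

End Topology.

(** * Urysohn functions for the coarser topology *)

Lemma uniform_bound (T : nat -> nat -> Prop) (n : nat) :
  (forall i m m', (m <= m')%nat -> T i m -> T i m') ->
  (forall i, (i < n)%nat -> exists m, T i m) ->
  exists m, forall i, (i < n)%nat -> T i m.
Proof.
  intros Hmono; induction n as [| n IH]; intros H; [exists 0%nat; intros; lia |].
  destruct IH as [m Hm]; [intros i Hi; apply H; lia |].
  destruct (H n) as [m' Hm']; [lia |].
  exists (Nat.max m m'); intros i Hi.
  destruct (Nat.eq_dec i n) as [-> | Hne].
  - apply (Hmono n m'); [lia | exact Hm'].
  - apply (Hmono i m); [lia | apply Hm; lia].
Qed.

Lemma nat_ceiling (r : R) : 0 <= r -> exists n : nat, r < INR n <= r + 1.
Proof.
  intros Hr; exists (Z.to_nat (up r)).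
  destruct (archimed r) as [H1 H2].
  rewrite INR_IZR_INZ, Z2Nat.id; [lra |].
  apply le_IZR; lra.
Qed.

Lemma pow_half_small (r : R) : 0 < r -> exists k, / 2 ^ k < r.
Proof.
  intros Hr; destruct (small_inv r Hr) as [k Hk]; exists (S k).
  eapply Rle_lt_trans; [| exact Hk].
  apply Rinv_le_contravar; [apply lt_0_INR; lia |].
  generalize (S k); intros n; induction n as [| n IH]; [simpl; lra |].
  rewrite S_INR; simpl; pose proof (pow_R1_Rle 2 n); lra.
Qed.

Section Urysohn.

Context {X : Type} (d : X -> X -> R) (Hm : is_metric d).
Context (B G : nat -> X -> Prop).
Hypothesis HB : forall i, is_clopen d (B i).
Hypothesis HG : forall n, wclosed B (G n).
Hypothesis HGbasis : forall x U, is_nbhd d x U ->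
  exists n, is_nbhd d x (G n) /\ forall y, G n y -> U y.

Lemma nbhd_interior x U :
  is_nbhd d x U -> is_nbhd d x (fun y => is_nbhd d y U).
Proof.
  intros [e [He H]]; exists e; split; [exact He | intros y Hy].
  apply (nbhd_imp d y (fun z => d x z < e)); [exact H |].
  exact (ball_open d Hm x e y Hy).
Qed.

Lemma wclosed_or A A' :
  wclosed B A -> wclosed B A' -> wclosed B (fun x => A x \/ A' x).
Proof.
  intros H H' y Hy.
  destruct (H y) as [n Hn]; [tauto |].
  destruct (H' y) as [m Hm']; [tauto |].
  exists (Nat.max n m); intros z Hz [Az | Az].
  - apply (Hn z); [eapply sim_le; [| exact Hz]; lia | exact Az].
  - apply (Hm' z); [eapply sim_le; [| exact Hz]; lia | exact Az].
Qed.

(** The sets [{x | exists a, A a /\ sim B n a x}] decrease to the w-closed set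
    [A].  Cutting [G n] down to the [n]-th of them makes the countable union
    below w-closed, because off [A] it is locally finite. *)
Definition enlarge (good : nat -> Prop) (A : X -> Prop) (x : X) : Prop :=
  exists n, good n /\ G n x /\ exists a, A a /\ sim B n a x.

(** If the class of [x] at level [N] misses [A], then for [n >= N] no point of [A] agrees up to [n]
    with a point of that class. So only finitely many pieces of [enlarge] meet the class. *)
Lemma sim_neighborhood_locally (A : X -> Prop) x :
  wclosed B A -> ~ A x ->
  exists N, forall y, sim B N x y ->
    ~ A y /\ forall n a, A a -> sim B n a y -> (n < N)%nat.
Proof.
  intros HA Hx; destruct (HA x Hx) as [N HN].
  exists N; intros y Hy; split; [exact (HN y Hy) |].
  intros n a Ha Hay; apply Nat.nle_gt; intros Hn; apply (HN a); [| exact Ha].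
  apply (sim_trans _ _ _ y); [exact Hy |].
  apply sim_sym, (sim_le _ _ n); assumption.
Qed.

(** Near a point outside, only the pieces with [n < N] matter, and each is w-closed: [G n] is, and
    so is a union of classes of [sim B n]. *)
Lemma enlarge_wclosed good A :
  wclosed B A -> (forall x, A x -> enlarge good A x) ->
  wclosed B (enlarge good A).
Proof.
  intros HA Hsub y Hy.
  assert (Hy' : ~ A y) by auto.
  destruct (sim_neighborhood_locally A y HA Hy') as [N HN].
  destruct (uniform_bound
    (fun n m => forall z, sim B m y z ->
       ~ (good n /\ G n z /\ exists a, A a /\ sim B n a z)) N) as [M HM].
  - intros n m m' Hmm H z Hz; apply H; eapply sim_le; eassumption.
  - intros n _.
    destruct (classic (good n)) as [Hgood | Hgood]; [| exists 0%nat; tauto].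
    destruct (classic (G n y)) as [HGy | HGy].
    + exists n; intros z Hz [_ [_ [a [Ha Haz]]]]; apply Hy.
      exists n; split; [exact Hgood |]; split; [exact HGy |].
      exists a; split; [exact Ha |].
      apply (sim_trans _ _ _ z); [exact Haz | apply sim_sym, Hz].
    + destruct (HG n y HGy) as [m Hm']; exists m.
      intros z Hz [_ [HGz _]]; exact (Hm' z Hz HGz).
  - exists (Nat.max N M); intros z Hz [n [Hgood [HGz [a [Ha Haz]]]]].
    assert (Hn : (n < N)%nat).
    { apply (HN z) with (a := a); [| exact Ha | exact Haz].
      eapply sim_le; [| exact Hz]; lia. }
    apply (HM n Hn z); [eapply sim_le; [| exact Hz]; lia |].
    split; [exact Hgood |]; split; [exact HGz |]; exists a; auto.
Qed.

Lemma enlarge_nbhd good A x :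
  (exists n, good n /\ is_nbhd d x (G n)) -> A x -> is_nbhd d x (enlarge good A).
Proof.
  intros [n [Hgood Hn]] Ax.
  apply (nbhd_imp d x (fun y => G n y /\ sim B n x y)).
  - intros y [Hy Hxy]; exists n; split; [exact Hgood |]; split; [exact Hy |].
    exists x; auto.
  - apply nbhd_and; [exact Hn | apply nbhd_sim, HB].
Qed.

(** Closedness refers to the coarser topology, the room between successive sets to the topology of
    [d]. Indices run through all of [nat] so that the resulting function may be unbounded. *)
Definition is_chain (A : nat -> X -> Prop) : Prop :=
  (forall i, wclosed B (A i)) /\ (forall i x, A i x -> is_nbhd d x (A (S i))).

(** Old sets move to the even positions. At the odd ones [A i] is enlarged by means of those [G n]
    that lie in the interior of [A (S i)], which leaves room on both sides. *)
Definition refine (A : nat -> X -> Prop) (i : nat) : X -> Prop :=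
  if Nat.even i then A (Nat.div2 i)
  else enlarge (fun n => forall y, G n y -> is_nbhd d y (A (S (Nat.div2 i))))
         (A (Nat.div2 i)).

Lemma refine_even A i : refine A (2 * i) = A i.
Proof.
  unfold refine; rewrite Nat.even_even, Nat.div2_double; reflexivity.
Qed.

Lemma refine_odd A i :
  refine A (S (2 * i)) =
  enlarge (fun n => forall y, G n y -> is_nbhd d y (A (S i))) (A i).
Proof.
  unfold refine; rewrite Nat.div2_succ_double.
  replace (S (2 * i)) with (2 * i + 1)%nat by lia.
  rewrite Nat.even_odd; reflexivity.
Qed.

Lemma refine_chain A : is_chain A -> is_chain (refine A).
Proof.
  intros [H1 H2].
  assert (Hodd : forall i x, A i x -> is_nbhd d x (refine A (S (2 * i)))).
  { intros i x Hx; rewrite refine_odd; apply enlarge_nbhd; [| exact Hx].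
    destruct (HGbasis x (fun y => is_nbhd d y (A (S i)))) as [n [Hn1 Hn2]].
    - apply nbhd_interior, H2, Hx.
    - exists n; auto. }
  split; intros i; destruct (Nat.Even_or_Odd i) as [[j ->] | [j ->]].
  - rewrite refine_even; apply H1.
  - replace (2 * j + 1)%nat with (S (2 * j)) by lia.
    rewrite refine_odd; apply enlarge_wclosed; [apply H1 |].
    intros x Hx; apply (nbhd_mem d Hm); rewrite <- refine_odd; auto.
  - intros x; rewrite refine_even; apply Hodd.
  - intros x; replace (2 * j + 1)%nat with (S (2 * j)) by lia.
    rewrite refine_odd.
    replace (S (S (2 * j))) with (2 * (S j))%nat by lia; rewrite refine_even.
    intros [n [Hn [Hx _]]]; exact (Hn x Hx).
Qed.

(** Index [i] at level [k] stands for the dyadic number [i / 2^k]; by [dyadic_chain_scale] the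
    choice of the fraction does not matter. *)
Fixpoint dyadic_chain (C : nat -> X -> Prop) (k : nat) : nat -> X -> Prop :=
  match k with
  | O => C
  | S k => refine (dyadic_chain C k)
  end.

Lemma dyadic_chain_chain C k : is_chain C -> is_chain (dyadic_chain C k).
Proof. intros HC; induction k; [exact HC | apply refine_chain; assumption]. Qed.

Lemma dyadic_chain_scale C k l i :
  dyadic_chain C (l + k) (2 ^ l * i) = dyadic_chain C k i.
Proof.
  induction l as [| l IH]; [simpl; f_equal; lia |].
  replace (2 ^ S l * i)%nat with (2 * (2 ^ l * i))%nat by (simpl; lia).
  change (refine (dyadic_chain C (l + k)) (2 * (2 ^ l * i)) = dyadic_chain C k i).
  rewrite refine_even; exact IH.
Qed.

Lemma chain_le A i j x : is_chain A -> (i <= j)%nat -> A i x -> A j x.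
Proof.
  intros [_ H] Hij Hx; induction Hij as [| j _ IH]; [exact Hx |].
  apply (nbhd_mem d Hm), H, IH.
Qed.

Lemma dyadic_chain_le C k l i j x :
  is_chain C -> INR i / 2 ^ k <= INR j / 2 ^ l ->
  dyadic_chain C k i x -> dyadic_chain C l j x.
Proof.
  intros HC Hij Hx.
  rewrite <- (dyadic_chain_scale C l k j).
  rewrite <- (dyadic_chain_scale C k l i) in Hx.
  rewrite Nat.add_comm.
  apply (chain_le _ (2 ^ l * i)); [apply dyadic_chain_chain, HC | | exact Hx].
  apply INR_le; rewrite !mult_INR, !pow_INR.
  assert (Hk : 0 < 2 ^ k) by (apply pow_lt; lra).
  assert (Hl : 0 < 2 ^ l) by (apply pow_lt; lra).
  replace (INR 2) with 2 by reflexivity.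
  apply (Rmult_le_compat_r (2 ^ k * 2 ^ l)) in Hij; [| nra].
  replace (INR i / 2 ^ k * (2 ^ k * 2 ^ l)) with (2 ^ l * INR i) in Hij
    by (field; lra).
  replace (INR j / 2 ^ l * (2 ^ k * 2 ^ l)) with (2 ^ k * INR j) in Hij
    by (field; lra).
  exact Hij.
Qed.

(** [f x] is the supremum of the dyadic numbers whose set omits [x]. Omission persists on a class of
    [sim B n], whence [wlsc]; the room between successive sets gives [usc]. *)
Lemma chain_function C :
  is_chain C -> (forall x, exists n, C n x) ->
  exists f : X -> R,
    (forall x, 0 <= f x) /\ wlsc B f /\ usc d f /\
    (forall n x, C n x -> f x <= INR n) /\
    (forall n x, f x < INR n -> C n x).
Proof.
  intros HC Hcov.
  (* Zero makes the set non-empty and its supremum non-negative. *)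
  set (T := fun x t => t = 0 \/
    exists k i, ~ dyadic_chain C k i x /\ t = INR i / 2 ^ k).
  assert (Hupper : forall k i x, dyadic_chain C k i x ->
            is_upper_bound (T x) (INR i / 2 ^ k)).
  { intros k i x Hx t [-> | [l [j [Hj ->]]]].
    - apply Rmult_le_pos; [apply pos_INR |].
      left; apply Rinv_0_lt_compat, pow_lt; lra.
    - apply Rnot_lt_le; intros Hlt; apply Hj.
      apply (dyadic_chain_le C k l i); [exact HC | lra | exact Hx]. }
  destruct (functional_choice (fun x r => is_lub (T x) r)) as [f Hf].
  { intros x; destruct (completeness (T x)) as [r Hr]; [| | exists r; exact Hr].
    - destruct (Hcov x) as [n Hn]; exists (INR n / 2 ^ 0).
      exact (Hupper 0%nat n x Hn).
    - exists 0; left; reflexivity. }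
  assert (Hle : forall k i x, dyadic_chain C k i x -> f x <= INR i / 2 ^ k).
  { intros k i x Hx; apply Hf, Hupper, Hx. }
  assert (Hlt : forall k i x, f x < INR i / 2 ^ k -> dyadic_chain C k i x).
  { intros k i x Hx; apply NNPP; intros Hn; apply (Rlt_not_le _ _ Hx).
    apply Hf; right; exists k, i; auto. }
  assert (Hpos : forall x, 0 <= f x).
  { intros x; apply Hf; left; reflexivity. }
  exists f; split; [exact Hpos |]; split; [| split; [| split]].
  - intros x s Hs.
    assert (Ht : exists t, T x t /\ s < t).
    { apply NNPP; intros Hn; apply (Rlt_not_le _ _ Hs), Hf.
      intros t Ht; apply Rnot_lt_le; intros Hst; apply Hn; exists t; auto. }
    destruct Ht as [t [[-> | [k [i [Hi ->]]]] Hst]].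
    + exists 0%nat; intros y _; specialize (Hpos y); lra.
    + destruct (proj1 (dyadic_chain_chain C k HC) i x Hi) as [n Hn].
      exists n; intros y Hy; eapply Rlt_le_trans; [exact Hst |].
      apply Hf; right; exists k, i; auto.
  - intros x t Ht.
    destruct (pow_half_small ((t - f x) / 2)) as [k Hk]; [lra |].
    assert (H2 : 0 < 2 ^ k) by (apply pow_lt; lra).
    (* The set of index [i] contains [x], so that of index [S i] is a neighborhood of [x], and there
       [f] is at most [f x + 2 / 2^k < t]. *)
    destruct (nat_ceiling (f x * 2 ^ k)) as [i [Hi1 Hi2]];
      [specialize (Hpos x); nra |].
    apply (nbhd_imp d x (dyadic_chain C k (S i))).
    + intros y Hy; apply Hle in Hy; eapply Rle_lt_trans; [exact Hy |].
      rewrite S_INR.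
      assert (Hb : (INR i + 1) / 2 ^ k <= (f x * 2 ^ k + 2) / 2 ^ k).
      { apply Rmult_le_compat_r; [left; apply Rinv_0_lt_compat, H2 | lra]. }
      replace ((f x * 2 ^ k + 2) / 2 ^ k) with (f x + 2 * / 2 ^ k) in Hb
        by (field; lra).
      lra.
    + apply (proj2 (dyadic_chain_chain C k HC)), Hlt.
      apply (Rmult_lt_reg_r (2 ^ k)); [exact H2 |].
      unfold Rdiv; rewrite Rmult_assoc, Rinv_l, Rmult_1_r; lra.
  - intros n x Hx; specialize (Hle 0%nat n x Hx); simpl in Hle; lra.
  - intros n x Hx; apply (Hlt 0%nat n x); simpl; lra.
Qed.

End Urysohn.

(** * The function phi *)

Lemma wlsc_const {X} (B : nat -> X -> Prop) c : wlsc B (fun _ => c).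
Proof. intros x s Hs; exists 0%nat; auto. Qed.

Lemma wlsc_add {X} (B : nat -> X -> Prop) f g :
  wlsc B f -> wlsc B g -> wlsc B (fun x => f x + g x).
Proof.
  intros Hf Hg x s Hs.
  destruct (Hf x (f x - (f x + g x - s) / 2)) as [n Hn]; [lra |].
  destruct (Hg x (g x - (f x + g x - s) / 2)) as [m Hm]; [lra |].
  exists (Nat.max n m); intros y Hy.
  assert (H1 : sim B n x y) by (eapply sim_le; [| exact Hy]; lia).
  assert (H2 : sim B m x y) by (eapply sim_le; [| exact Hy]; lia).
  specialize (Hn y H1); specialize (Hm y H2); lra.
Qed.

Lemma wlsc_scale {X} (B : nat -> X -> Prop) f c :
  0 < c -> wlsc B f -> wlsc B (fun x => f x / c).
Proof.
  intros Hc Hf x s Hs.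
  assert (Hsc : forall y, s < f y / c <-> s * c < f y).
  { intros y; split; intros H.
    - apply (Rmult_lt_compat_r c) in H; [| exact Hc].
      replace (f y / c * c) with (f y) in H by (field; lra); exact H.
    - apply (Rmult_lt_reg_r c); [exact Hc |].
      replace (f y / c * c) with (f y) by (field; lra); exact H. }
  destruct (Hf x (s * c)) as [n Hn]; [apply Hsc, Hs |].
  exists n; intros y Hy; apply Hsc, Hn, Hy.
Qed.

Lemma wlsc_sum {X} (B : nat -> X -> Prop) (h : nat -> X -> R) J :
  (forall n, wlsc B (h n)) -> wlsc B (fun x => sum_f_R0 (fun n => h n x) J).
Proof.
  intros H; induction J as [| J IH]; [apply H | apply wlsc_add; [exact IH | apply H]].
Qed.

Lemma usc_add {X} (d : X -> X -> R) f g :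
  usc d f -> usc d g -> usc d (fun x => f x + g x).
Proof.
  intros Hf Hg x t Ht.
  apply (nbhd_imp d x (fun y => f y < f x + (t - (f x + g x)) / 2 /\
                                g y < g x + (t - (f x + g x)) / 2)).
  - intros y; lra.
  - apply nbhd_and; [apply Hf | apply Hg]; lra.
Qed.

Lemma usc_scale {X} (d : X -> X -> R) f c :
  0 < c -> usc d f -> usc d (fun x => f x / c).
Proof.
  intros Hc Hf x t Ht.
  assert (Hsc : forall y, f y / c < t <-> f y < t * c).
  { intros y; split; intros H.
    - apply (Rmult_lt_compat_r c) in H; [| exact Hc].
      replace (f y / c * c) with (f y) in H by (field; lra); exact H.
    - apply (Rmult_lt_reg_r c); [exact Hc |].
      replace (f y / c * c) with (f y) by (field; lra); exact H. }
  apply (nbhd_imp d x (fun y => f y < t * c)); [apply Hsc |].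
  apply Hf, Hsc, Ht.
Qed.

Lemma usc_sum {X} (d : X -> X -> R) (h : nat -> X -> R) J :
  (forall n, usc d (h n)) -> usc d (fun x => sum_f_R0 (fun n => h n x) J).
Proof.
  intros H; induction J as [| J IH]; [apply H | apply usc_add; [exact IH | apply H]].
Qed.

Lemma sum_le_geometric (a : nat -> R) J :
  (forall n, a n <= 2 / 2 ^ n) ->
  forall k, sum_f_R0 a (k + J) <= sum_f_R0 a J + 2 / 2 ^ J.
Proof.
  intros Ha k.
  (* Keeping the remaining tail of the geometric series makes the induction close. *)
  assert (H : sum_f_R0 a (k + J) <= sum_f_R0 a J + 2 / 2 ^ J - 2 / 2 ^ (k + J)).
  { induction k as [| k IH]; [simpl; lra |].
    simpl Nat.add; rewrite tech5; specialize (Ha (S (k + J))).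
    assert (Hp : 0 < 2 ^ (k + J)) by (apply pow_lt; lra).
    assert (E : 2 / 2 ^ (k + J) = 2 / 2 ^ S (k + J) + 2 / 2 ^ S (k + J)).
    { change (2 ^ S (k + J)) with (2 * 2 ^ (k + J)); field; lra. }
    lra. }
  assert (Hp : 0 < 2 / 2 ^ (k + J)).
  { apply Rdiv_lt_0_compat; [lra | apply pow_lt; lra]. }
  lra.
Qed.

Lemma sum_le_more (a : nat -> R) J K :
  (forall n, 0 <= a n) -> (J <= K)%nat -> sum_f_R0 a J <= sum_f_R0 a K.
Proof.
  intros Ha HJK; induction HJK as [| K _ IH]; [lra |].
  rewrite tech5; specialize (Ha (S K)); lra.
Qed.

Lemma sum_split_term (a : nat -> R) j J :
  (j <= J)%nat ->
  sum_f_R0 a J = sum_f_R0 (fun n => if Nat.eq_dec n j then 0 else a n) J + a j.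
Proof.
  intros H; induction H as [| J H IH].
  - destruct j as [| j]; [simpl; lra |]; rewrite !tech5.
    destruct (Nat.eq_dec (S j) (S j)) as [_ | Hn]; [| lia].
    rewrite (sum_eq (fun n => if Nat.eq_dec n (S j) then 0 else a n) a); [lra |].
    intros i Hi; destruct (Nat.eq_dec i (S j)); [lia | reflexivity].
  - rewrite !tech5, IH.
    destruct (Nat.eq_dec (S J) j); [lia | lra].
Qed.

Section Lelek.

Context {X : Type} (d : X -> X -> R) (Hm : is_metric d).

(** Cohesion says that every point has a thin neighborhood. *)
Definition thin (A : X -> Prop) : Prop :=
  forall C, is_clopen d C -> (forall y, C y -> A y) -> forall y, ~ C y.

Lemma thin_subset (A A' : X -> Prop) :
  (forall x, A x -> A' x) -> thin A' -> thin A.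
Proof. intros H HA' C HC HCA; apply (HA' C HC); auto. Qed.

Section Basis.

Context (B G : nat -> X -> Prop).
Hypothesis HB : forall i, is_clopen d (B i).
Hypothesis HG : forall n, wclosed B (G n).
Hypothesis HGbasis : forall x U, is_nbhd d x U ->
  exists n, is_nbhd d x (G n) /\ forall y, G n y -> U y.

(** If a clopen [C] inside the union had a point off [A], a class of that point would miss [A], and
    its clopen trace on [C] would lie in [A']. Hence [C] lies in [A]. *)
Lemma thin_or A A' :
  wclosed B A -> thin A -> thin A' -> thin (fun x => A x \/ A' x).
Proof.
  intros HA tA tA' C HC HCA y Cy.
  apply (tA C HC) with (y := y); [| exact Cy].
  intros z Cz; apply NNPP; intros Az.
  destruct (HA z Az) as [n Hn].
  apply (tA' (fun w => C w /\ sim B n z w)) with (y := z).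
  - apply clopen_and; [exact HC | apply clopen_sim, HB].
  - intros w [Cw Hw]; destruct (HCA w Cw) as [Aw | Aw]; [| exact Aw].
    destruct (Hn w Hw Aw).
  - split; [exact Cz | apply sim_refl].
Qed.

Let T (n : nat) : Prop := thin (G n).

Lemma thin_union N : thin (fun x => exists n, (n < N)%nat /\ T n /\ G n x).
Proof.
  induction N as [| N IH].
  - intros C _ H y Cy; destruct (H y Cy) as [n [Hn _]]; lia.
  - destruct (classic (T N)) as [HT | HT].
    + eapply thin_subset; [| exact (thin_or (G N) _ (HG N) HT IH)].
      intros x [n [Hn Hx]]; destruct (Nat.eq_dec n N) as [-> | Hne]; [tauto |].
      right; exists n; split; [lia | exact Hx].
    + eapply thin_subset; [| exact IH].
      intros x [n [Hn [HTn Hx]]]; exists n; split; [| auto].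
      destruct (Nat.eq_dec n N) as [-> | Hne]; [tauto | lia].
Qed.

(** Off [A] the enlargement is locally contained in a finite union of thin sets [G n], so its part
    outside [A] is thin. *)
Lemma thin_enlarge A : wclosed B A -> thin A -> thin (enlarge B G T A).
Proof.
  intros HA tA.
  assert (H : thin (fun x => A x \/ (enlarge B G T A x /\ ~ A x))).
  { apply thin_or; [exact HA | exact tA |].
    intros C HC HCA y Cy; destruct (HCA y Cy) as [_ Ay].
    destruct (sim_neighborhood_locally B A y HA Ay) as [N HN].
    apply (thin_union N (fun z => C z /\ sim B N y z)) with (y := y).
    - apply clopen_and; [exact HC | apply clopen_sim, HB].
    - intros z [Cz Hz]; destruct (HCA z Cz) as [[n [Tn [Gn [a [Aa Ha]]]]] _].
      exists n; split; [| auto].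
      exact (proj2 (HN z Hz) n a Aa Ha).
    - split; [exact Cy | apply sim_refl]. }
  eapply thin_subset; [| exact H].
  intros x Hx; destruct (classic (A x)); auto.
Qed.

(** The function comes from a chain of thin w-closed sets exhausting the space: where it is below
    [n] the point lies in the thin set [C n], so no non-empty clopen set can have it bounded. *)
Lemma function_unbounded_on_clopens :
  cohesive d ->
  exists f : X -> R,
    (forall x, 0 <= f x) /\ wlsc B f /\ usc d f /\
    (forall C x M, is_clopen d C -> C x -> exists y, C y /\ M < f y).
Proof.
  intros Hcoh.
  assert (Hcov : forall x, exists n, T n /\ is_nbhd d x (G n)).
  { intros x; destruct (Hcoh x) as [N [HN HNthin]].
    destruct (HGbasis x N HN) as [n [Hn1 Hn2]].
    exists n; split; [| exact Hn1].
    exact (thin_subset (G n) N Hn2 HNthin). }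
  (* The enlargement gives room around the previous set, and adding every thin [G n] exhausts the
     space. *)
  set (C := fix C (n : nat) : X -> Prop :=
    match n with
    | O => fun _ => False
    | S n => fun x => enlarge B G T (C n) x \/ (T n /\ G n x)
    end).
  assert (HC : forall n, wclosed B (C n) /\ thin (C n)).
  { induction n as [| n [IH1 IH2]].
    - split.
      + intros y _; exists 0%nat; auto.
      + intros D _ H y Dy; exact (H y Dy).
    - assert (Hcl : wclosed B (enlarge B G T (C n))).
      { apply enlarge_wclosed; [exact HG | exact IH1 |].
        intros x Hx; apply (nbhd_mem d Hm), (enlarge_nbhd d B G HB); auto. }
      split.
      + apply wclosed_or; [exact Hcl |].
        destruct (classic (T n)) as [HT | HT].
        * intros y Hy; destruct (HG n y) as [m Hm']; [tauto |].
          exists m; intros z Hz; specialize (Hm' z Hz); tauto.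
        * intros y _; exists 0%nat; tauto.
      + apply thin_or; [exact Hcl | apply thin_enlarge; assumption |].
        destruct (classic (T n)) as [HT | HT].
        * apply (thin_subset _ (G n)); [tauto | exact HT].
        * intros D _ H y Dy; destruct (H y Dy) as [HT' _]; tauto. }
  destruct (chain_function d Hm B G HB HG HGbasis C) as [f [Hf0 [Hf1 [Hf2 [_ Hf3]]]]].
  - split; [intros n; apply HC |].
    intros n x Hx; apply (nbhd_imp d x (enlarge B G T (C n))).
    + intros y Hy; left; exact Hy.
    + apply (enlarge_nbhd d B G HB); auto.
  - intros x; destruct (Hcov x) as [n [Tn Hn]]; exists (S n); right.
    split; [exact Tn | exact (nbhd_mem d Hm x _ Hn)].
  - exists f; split; [exact Hf0 |]; split; [exact Hf1 |]; split; [exact Hf2 |].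
    intros D x M HD Dx; apply NNPP; intros Hno.
    destruct (nat_ceiling (Rmax M 0)) as [n [Hn _]]; [apply Rmax_r |].
    apply (proj2 (HC n) D HD) with (y := x); [| exact Dx].
    intros y Dy; apply Hf3; eapply Rle_lt_trans; [| exact Hn].
    eapply Rle_trans; [| apply Rmax_l].
    apply Rnot_lt_le; intros Hy; apply Hno; exists y; auto.
Qed.

(** There is one function for each pair with [G i] inside the interior of [G j], built from the
    chain [G i], [G j], whole space. It vanishes on [G i], is below 1 only in [G j], and never
    exceeds 2. *)
Lemma separating_functions :
  exists g : nat -> X -> R,
    (forall n x, 0 <= g n x <= 2) /\
    (forall n, wlsc B (g n)) /\ (forall n, usc d (g n)) /\
    (forall x delta, 0 < delta ->
       exists n, g n x = 0 /\ forall y, g n y < 1 -> d x y < delta).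
Proof.
  destruct (functional_choice (fun (w : nat) (g : X -> R) =>
    (forall x, 0 <= g x <= 2) /\ wlsc B g /\ usc d g /\
    ((forall x, G (fst (Cantor.of_nat w)) x ->
                is_nbhd d x (G (snd (Cantor.of_nat w)))) ->
     (forall x, G (fst (Cantor.of_nat w)) x -> g x = 0) /\
     (forall x, g x < 1 -> G (snd (Cantor.of_nat w)) x)))) as [g Hg].
  { intros w; destruct (Cantor.of_nat w) as [i j]; simpl fst; simpl snd.
    destruct (classic (forall x, G i x -> is_nbhd d x (G j))) as [Hij | Hij].
    - set (C := fun n : nat => match n with
        | O => G i
        | S O => G j
        | _ => fun _ => True
        end).
      destruct (chain_function d Hm B G HB HG HGbasis C)
        as [f [Hf0 [Hf1 [Hf2 [Hf3 Hf4]]]]].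
      + split.
        * intros [| [| n]]; simpl; [apply HG | apply HG |].
          intros y Hy; tauto.
        * intros [| n] x Hx; simpl; [apply Hij, Hx | apply nbhd_true].
      + intros x; exists 2%nat; exact I.
      + exists f; split; [| split; [exact Hf1 | split; [exact Hf2 |]]].
        * intros x; split; [apply Hf0 |].
          exact (Hf3 2%nat x I).
        * intros _; split.
          -- intros x Hx; apply Rle_antisym; [exact (Hf3 0%nat x Hx) | apply Hf0].
          -- intros x Hx; exact (Hf4 1%nat x Hx).
    - exists (fun _ => 0); split; [intros x; lra |].
      split; [apply wlsc_const |].
      split; [intros x t Ht; apply (nbhd_imp d x (fun _ => True)); auto;
              apply nbhd_true | tauto]. }
  exists g; split; [apply Hg |]; split; [apply Hg |]; split; [apply Hg |].
  intros x delta Hdelta.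
  destruct (HGbasis x (fun y => d x y < delta)) as [j [Hj1 Hj2]].
  { exists delta; auto. }
  destruct (HGbasis x (fun y => is_nbhd d y (G j))) as [i [Hi1 Hi2]].
  { apply nbhd_interior; assumption. }
  destruct (Hg (Cantor.to_nat (i, j))) as [_ [_ [_ H]]].
  rewrite Cantor.cancel_of_to in H; simpl fst in H; simpl snd in H.
  destruct (H Hi2) as [H1 H2].
  exists (Cantor.to_nat (i, j)); split; [| auto].
  apply H1, (nbhd_mem d Hm), Hi1.
Qed.

End Basis.

(** [phi] is the sum of the function unbounded on clopen sets and the series of the separating
    functions divided by [2^n]. Uniform convergence passes both semicontinuities to the sum. *)
Lemma lelek_function :
  separable d -> almost_zero_dimensional d -> cohesive d ->
  exists (B : nat -> X -> Prop) (phi : X -> R),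
    (forall i, is_clopen d (B i)) /\
    (forall x, 0 <= phi x) /\ wlsc B phi /\ usc d phi /\
    (forall x delta, 0 < delta -> exists N eta, 0 < eta /\
       forall y, sim B N x y -> phi y < phi x + eta -> d x y < delta) /\
    (forall C x M, is_clopen d C -> C x -> exists y, C y /\ M < phi y).
Proof.
  intros Hsep Hazd Hcoh.
  destruct (azd_countable_basis d Hm Hsep Hazd) as [B [G [HB [HG HGb]]]].
  destruct (function_unbounded_on_clopens B G HB HG HGb Hcoh)
    as [f [Hf0 [Hf1 [Hf2 Hf3]]]].
  destruct (separating_functions B G HB HG HGb) as [g [Hg0 [Hg1 [Hg2 Hg3]]]].
  set (h := fun n x => g n x / 2 ^ n).
  set (S := fun J x => sum_f_R0 (fun n => h n x) J).
  assert (H2 : forall n, 0 < 2 ^ n) by (intros n; apply pow_lt; lra).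
  assert (Hh : forall n x, 0 <= h n x <= 2 / 2 ^ n).
  { intros n x; specialize (Hg0 n x); specialize (H2 n); unfold h; split.
    - apply Rmult_le_pos; [lra | left; apply Rinv_0_lt_compat, H2].
    - apply Rmult_le_compat_r; [left; apply Rinv_0_lt_compat, H2 | lra]. }
  assert (Hlub : forall x, exists l, is_lub (fun s => exists J, s = S J x) l).
  { intros x; destruct (completeness (fun s => exists J, s = S J x)) as [l Hl];
      [| | exists l; exact Hl].
    - exists (S 0%nat x + 2 / 2 ^ 0); intros s [J ->].
      replace J with (J + 0)%nat by lia.
      apply (sum_le_geometric (fun n => h n x)); intros n; apply Hh.
    - exists (S 0%nat x), 0%nat; reflexivity. }
  destruct (functional_choice _ Hlub) as [l Hl].
  assert (Hlow : forall J x, S J x <= l x) by (intros J x; apply Hl; exists J; auto).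
  assert (Hup : forall J x, l x <= S J x + 2 / 2 ^ J).
  { intros J x; apply Hl; intros s [K ->].
    apply Rle_trans with (S (K + J)%nat x).
    - apply (sum_le_more (fun n => h n x)); [intros n; apply Hh | lia].
    - apply (sum_le_geometric (fun n => h n x)); intros n; apply Hh. }
  assert (Hsmall : forall r, 0 < r -> exists J, 2 / 2 ^ J < r).
  { intros r Hr; destruct (pow_half_small (r / 2)) as [J HJ]; [lra |].
    exists J; unfold Rdiv; lra. }
  assert (HSl : forall J, wlsc B (S J)).
  { intros J; apply wlsc_sum; intros n; apply wlsc_scale; auto. }
  assert (HSu : forall J, usc d (S J)).
  { intros J; apply usc_sum; intros n; apply usc_scale; auto. }
  exists B, (fun x => f x + l x); split; [exact HB |].
  split; [| split; [| split; [| split]]].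
  - intros x; specialize (Hf0 x); specialize (Hlow 0%nat x).
    assert (0 <= S 0%nat x) by apply Hh; lra.
  - intros x s Hs; destruct (Hsmall (f x + l x - s)) as [J HJ]; [lra |].
    destruct (wlsc_add B f (S J) Hf1 (HSl J) x s) as [n Hn].
    { specialize (Hup J x); lra. }
    exists n; intros y Hy; specialize (Hn y Hy); specialize (Hlow J y); lra.
  - intros x t Ht; destruct (Hsmall ((t - (f x + l x)) / 2)) as [J HJ]; [lra |].
    apply (nbhd_imp d x
      (fun y => f y + S J y < f x + l x + (t - (f x + l x)) / 2)).
    + intros y Hy; specialize (Hup J y); lra.
    + apply (usc_add d f (S J) Hf2 (HSu J)); specialize (Hlow J x); lra.
  - (* Every term of the series is lower semicontinuous, so an upper bound for
       the whole series near [x] is one for each single term. *)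
    intros x delta Hdelta; destruct (Hg3 x delta Hdelta) as [j [Hj1 Hj2]].
    (* The other terms lose less than [eta] and the total gains less than [eta], so the [j]-th term
       stays below [2 * eta], that is, [g j y < 1]. *)
    set (eta := / 2 ^ j / 2).
    assert (Heta : 0 < eta).
    { unfold eta; specialize (Rinv_0_lt_compat _ (H2 j)); lra. }
    destruct (Hsmall (eta / 2)) as [J HJ]; [lra |].
    set (K := Nat.max J j).
    set (h' := fun n y => if Nat.eq_dec n j then 0 else h n y).
    assert (HS : forall y, S K y = sum_f_R0 (fun n => h' n y) K + h j y).
    { intros y; apply (sum_split_term (fun n => h n y)); unfold K; lia. }
    assert (HK : S J x <= S K x).
    { apply (sum_le_more (fun n => h n x)); [intros n; apply Hh | unfold K; lia]. }
    assert (Hhj : h j x = 0) by (unfold h; rewrite Hj1; lra).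
    destruct (wlsc_add B f (fun y => sum_f_R0 (fun n => h' n y) K)) with
      (x := x) (s := f x + l x - eta) as [N HN].
    + exact Hf1.
    + apply wlsc_sum; intros n; unfold h'.
      destruct (Nat.eq_dec n j); [apply wlsc_const | apply wlsc_scale; auto].
    + specialize (HS x); specialize (Hup J x); lra.
    + exists N, eta; split; [exact Heta |]; intros y Hy Hphi.
      apply Hj2; specialize (HN y Hy); specialize (HS y).
      specialize (Hlow K y).
      assert (Hlt : h j y < / 2 ^ j) by (unfold eta in *; lra).
      unfold h in Hlt; apply (Rmult_lt_reg_r (/ 2 ^ j)).
      * apply Rinv_0_lt_compat, H2.
      * rewrite Rmult_1_l; exact Hlt.
  - intros C x M HC Cx; destruct (Hf3 C x M HC Cx) as [y [Cy Hy]].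
    exists y; split; [exact Cy |].
    specialize (Hlow 0%nat y); assert (0 <= S 0%nat y) by apply Hh; lra.
Qed.

End Lelek.

(** * Splitting clopen sets *)

Definition weight (n : nat) : R := (/ INR n) ^ 2.

Lemma weight_pos n : (1 <= n)%nat -> 0 < weight n.
Proof.
  intros Hn; unfold weight; apply pow_lt, Rinv_0_lt_compat, lt_0_INR; lia.
Qed.

Lemma weight_1 : weight 1 = 1.
Proof. unfold weight; simpl; field. Qed.

(** For [n] the integer just above [1 / sqrt t], the number [1/n] lies between [sqrt t / 2] and
    [sqrt t]; squaring yields the factor 4. For [t < eps] any weight below [eps] will do. *)
Lemma weight_scale t eps :
  0 <= t < 1 -> 0 < eps ->
  exists n, (1 <= n)%nat /\ weight n - eps <= t <= 4 * weight n + eps.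
Proof.
  intros Ht Heps; destruct (Rlt_le_dec t eps) as [Hlt | Hge].
  - destruct (small_inv (Rmin eps 1)) as [k Hk]; [apply Rmin_pos; lra |].
    exists (S k); split; [lia |].
    pose proof (Rmin_l eps 1); pose proof (Rmin_r eps 1).
    pose proof (weight_pos (S k) ltac:(lia)) as Hw.
    assert (Hk0 : 0 < / INR (S k)) by (apply Rinv_0_lt_compat, lt_0_INR; lia).
    unfold weight in *; nra.
  - assert (Hr : 0 < sqrt t) by (apply sqrt_lt_R0; lra).
    assert (Hrr : sqrt t * sqrt t = t) by (apply sqrt_sqrt; lra).
    set (r := sqrt t) in *.
    assert (Hr1 : r < 1) by nra.
    assert (Hir : 1 < / r) by (rewrite <- Rinv_1; apply Rinv_lt_contravar; lra).
    destruct (nat_ceiling (/ r)) as [n [Hn1 Hn2]]; [lra |].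
    assert (Hn0 : (1 <= n)%nat).
    { apply INR_le; simpl; lra. }
    exists n; split; [exact Hn0 |].
    assert (Hu : / INR n <= r).
    { rewrite <- (Rinv_inv r); apply Rinv_le_contravar; lra. }
    assert (Hl : r / 2 <= / INR n).
    { replace (r / 2) with (/ (2 * / r)) by (field; lra).
      apply Rinv_le_contravar; lra. }
    assert (Hp : 0 < / INR n) by (apply Rinv_0_lt_compat; lra).
    unfold weight; nra.
Qed.

Definition is_inf {X : Type} (phi : X -> R) (P : X -> Prop) (a : R) : Prop :=
  (forall x, P x -> a <= phi x) /\
  (forall eps, 0 < eps -> exists x, P x /\ phi x < a + eps).

(** A total function by way of [epsilon]; for non-negative [phi] it is the infimum as soon as [P] is
    non-empty. *)
Definition infimum {X : Type} (phi : X -> R) (P : X -> Prop) : R :=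
  epsilon (inhabits 0) (is_inf phi P).

Lemma infimum_is_inf {X : Type} (phi : X -> R) (P : X -> Prop) :
  (forall x, 0 <= phi x) -> (exists x, P x) -> is_inf phi P (infimum phi P).
Proof.
  intros Hpos [x0 Hx0]; unfold infimum; apply epsilon_spec.
  destruct (completeness (fun t => forall x, P x -> t <= phi x)) as [a [Ha1 Ha2]].
  - exists (phi x0); intros t Ht; apply Ht, Hx0.
  - exists 0; auto.
  - exists a; split.
    + intros x Hx; apply Ha2; intros t Ht; apply Ht, Hx.
    + intros eps Heps; apply NNPP; intros Hno.
      assert (Hb : a + eps <= a); [| lra].
      apply Ha1; intros x Hx; apply Rnot_lt_le; intros Hlt.
      apply Hno; exists x; auto.
Qed.

Lemma infimum_mono {X : Type} (phi : X -> R) (P Q : X -> Prop) :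
  (forall x, 0 <= phi x) -> (exists x, P x) -> (forall x, P x -> Q x) ->
  infimum phi Q <= infimum phi P.
Proof.
  intros Hpos HP HPQ.
  destruct (infimum_is_inf phi P Hpos HP) as [_ H2].
  destruct (infimum_is_inf phi Q Hpos) as [K1 _].
  { destruct HP as [x Hx]; exists x; auto. }
  apply Rnot_lt_le; intros Hlt.
  destruct (H2 (infimum phi Q - infimum phi P)) as [x [Hx Hx']]; [lra |].
  specialize (K1 x (HPQ x Hx)); lra.
Qed.

Section Splitting.

Context {X : Type} (d : X -> X -> R) (Hm : is_metric d).
Context (B : nat -> X -> Prop) (phi : X -> R).
Hypothesis HB : forall i, is_clopen d (B i).
Hypothesis phi_pos : forall x, 0 <= phi x.
Hypothesis phi_wlsc : wlsc B phi.
Hypothesis phi_usc : usc d phi.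
Hypothesis phi_unbounded :
  forall C x M, is_clopen d C -> C x -> exists y, C y /\ M < phi y.

(** If the value [t] were omitted on [P], the part of [P] with [phi < t] would be clopen by the two
    semicontinuities, and [phi] is bounded there. *)
Lemma phi_takes_value P p t :
  is_clopen d P -> P p -> phi p < t -> exists y, P y /\ phi y = t.
Proof.
  intros HP Pp Hp; apply NNPP; intros Hno.
  destruct (phi_unbounded (fun x => P x /\ phi x < t) p t) as [y [[_ Hy1] Hy2]];
    [| auto | lra].
  split.
  - intros x [Px Hx]; apply (nbhd_and d x P (fun y => phi y < t)).
    + exact (proj1 HP x Px).
    + apply phi_usc, Hx.
  - intros x Hx; destruct (classic (P x)) as [Px | Px].
    + apply (nbhd_imp d x (fun y => t < phi y)); [intros y Hy; lra |].
      apply (wlsc_lsc d B phi x t HB phi_wlsc).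
      destruct (Rtotal_order (phi x) t) as [H | [H | H]]; [tauto | | exact H].
      destruct Hno; exists x; auto.
    + apply (nbhd_imp d x (fun y => ~ P y)); [tauto |].
      exact (proj2 HP x Px).
Qed.

(** [Q] is the part of [P] with a positive answer. Up to [eps], the infimum rises by one to four
    times the weight on [Q] and by nothing on the rest. *)
Definition split_spec (P : X -> Prop) (eps : R) (n : nat) (Q : X -> Prop) : Prop :=
  is_clopen d Q /\ (forall x, Q x -> P x) /\
  (forall x, Q x -> infimum phi P + weight n - eps <= phi x) /\
  (exists x, Q x /\ phi x <= infimum phi P + 4 * weight n + eps) /\
  (exists x, P x /\ ~ Q x /\ phi x <= infimum phi P + eps).

(** [Q] is a small class, within [P], of a point where [phi] is exactly the infimum plus the weight.
    Since [phi] is too small at [p], the class leaves [p] out. *)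
Lemma split_avoiding P p eps n :
  is_clopen d P -> P p -> 0 < eps -> (1 <= n)%nat ->
  phi p < infimum phi P + weight n / 2 -> phi p <= infimum phi P + eps ->
  exists Q, split_spec P eps n Q /\ ~ Q p.
Proof.
  intros HP Pp Heps Hn Hp1 Hp2; pose proof (weight_pos n Hn) as Hw.
  destruct (phi_takes_value P p (infimum phi P + weight n)) as [y [Py Hy]];
    [exact HP | exact Pp | lra |].
  set (s := infimum phi P + weight n - Rmin eps (weight n / 2)).
  assert (Hmin : 0 < Rmin eps (weight n / 2)) by (apply Rmin_pos; lra).
  pose proof (Rmin_l eps (weight n / 2)); pose proof (Rmin_r eps (weight n / 2)).
  destruct (phi_wlsc y s) as [N HN]; [unfold s; lra |].
  assert (HQp : ~ (P p /\ sim B N y p)).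
  { intros [_ Hs]; specialize (HN p Hs); unfold s in HN; lra. }
  exists (fun x => P x /\ sim B N y x); split; [| exact HQp].
  split; [| split; [| split; [| split]]].
  - apply clopen_and; [exact HP | apply clopen_sim, HB].
  - tauto.
  - intros x [_ Hx]; specialize (HN x Hx); unfold s in HN; lra.
  - exists y; split; [split; [exact Py | apply sim_refl] | lra].
  - exists p; auto.
Qed.

Lemma split_weight P eps n :
  is_clopen d P -> (exists x, P x) -> 0 < eps -> (1 <= n)%nat ->
  exists Q, split_spec P eps n Q.
Proof.
  intros HP HPne Heps Hn; pose proof (weight_pos n Hn) as Hw.
  destruct (infimum_is_inf phi P phi_pos HPne) as [_ Hinf].
  destruct (Hinf (Rmin eps (weight n / 2))) as [p [Pp Hp]];
    [apply Rmin_pos; lra |].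
  pose proof (Rmin_l eps (weight n / 2)); pose proof (Rmin_r eps (weight n / 2)).
  destruct (split_avoiding P p eps n) as [Q [HQ _]]; try assumption; try lra.
  exists Q; exact HQ.
Qed.

Definition decided (j : nat) (P : X -> Prop) : Prop :=
  forall x y, P x -> P y -> (B j x <-> B j y).

(** If [phi] is large on the part of [P] that [B j] separates from the
    near-minimum [p], then no weight [1/n^2] matches the infimum over that
    part, so it is put undecided on the side of weight [1].  This happens
    finitely often along a branch, since [phi] is finite at each point. *)
Lemma split_decide P eps j :
  is_clopen d P -> (exists x, P x) -> 0 < eps ->
  exists n Q, (1 <= n)%nat /\ split_spec P eps n Q /\
    (n = 1%nat \/ decided j Q) /\ decided j (fun x => P x /\ ~ Q x).
Proof.
  intros HP HPne Heps.
  destruct (infimum_is_inf phi P phi_pos HPne) as [Hinf1 Hinf2].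
  set (a := infimum phi P) in *.
  destruct (Hinf2 (Rmin eps (/ 2))) as [p [Pp Hp]]; [apply Rmin_pos; lra |].
  pose proof (Rmin_l eps (/ 2)); pose proof (Rmin_r eps (/ 2)).
  set (Z := fun x => P x /\ ~ (B j p <-> B j x)).
  assert (HZ : is_clopen d Z).
  { apply clopen_and; [exact HP |].
    destruct (classic (B j p)) as [Hj | Hj].
    - apply (clopen_ext d (fun x => ~ B j x)); [tauto |].
      apply clopen_not, HB.
    - apply (clopen_ext d (B j)); [intros x; tauto | apply HB]. }
  destruct (classic (exists z, Z z /\ phi z < a + 1)) as [[z [Zz Hz]] | HZ1].
  - destruct (infimum_is_inf phi Z phi_pos) as [Hi1 Hi2]; [exists z; exact Zz |].
    assert (Ha : a <= infimum phi Z).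
    { apply infimum_mono; [exact phi_pos | exists z; exact Zz |].
      intros x [Px _]; exact Px. }
    specialize (Hi1 z Zz) as Hiz.
    (* The excess over [a] is below 1, so a weight matches it; half of [eps] is kept for the choice
       of a near-minimum on [Z]. *)
    destruct (weight_scale (infimum phi Z - a) (eps / 2)) as [n [Hn1 Hn2]];
      [lra | lra |].
    exists n, Z; split; [exact Hn1 |]; split; [| split].
    + split; [exact HZ |]; split; [intros x [Px _]; exact Px |].
      fold a; split; [| split].
      * intros x Zx; specialize (Hi1 x Zx); lra.
      * destruct (Hi2 (eps / 2)) as [x [Zx Hx]]; [lra |].
        exists x; split; [exact Zx | lra].
      * exists p; split; [exact Pp |]; split; [unfold Z; tauto | lra].
    + right; intros x y [_ Hx] [_ Hy]; tauto.
    + intros x y [Px Hx] [Py Hy]; unfold Z in *; tauto.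
  (* On [Z] the function is at least [a + 1], so [Z] may join [Q]; [p] stays outside, and all that
     remains agrees with [p] about [B j]. *)
  - destruct (split_avoiding P p eps 1) as [Q [[HQ1 [HQ2 [HQ3 [HQ4 HQ5]]]] HQp]];
      try assumption; try lia; try (rewrite weight_1); try (fold a; lra).
    exists 1%nat, (fun x => Q x \/ Z x); split; [lia |]; split; [| split].
    + split; [apply clopen_or; assumption |].
      split; [intros x [Qx | [Px _]]; [apply HQ2, Qx | exact Px] |].
      split; [| split].
      * intros x [Qx | Zx]; [apply HQ3, Qx |].
        rewrite weight_1; fold a; apply Rnot_lt_le; intros Hlt.
        apply HZ1; exists x; split; [exact Zx | lra].
      * destruct HQ4 as [x [Qx Hx]]; exists x; auto.
      * exists p; split; [exact Pp |]; split; [unfold Z; tauto | fold a; lra].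
    + left; reflexivity.
    + intros x y [Px Hx] [Py Hy]; unfold Z in *; tauto.
Qed.

End Splitting.

(** * The tree of cells *)

(** Stage [s] spends [tolerance (S s)], so the errors of stage [s] and all later stages add up to
    [tolerance s]. *)
Definition tolerance (s : nat) : R := / 2 ^ S s.

Lemma tolerance_pos s : 0 < tolerance s.
Proof. apply Rinv_0_lt_compat, pow_lt; lra. Qed.

Lemma tolerance_S s : tolerance s = tolerance (S s) + tolerance (S s).
Proof.
  unfold tolerance; change (2 ^ S (S s)) with (2 * 2 ^ S s).
  assert (0 < 2 ^ S s) by (apply pow_lt; lra); field; lra.
Qed.

Lemma tolerance_le_half s : tolerance s <= / 2.
Proof.
  induction s as [| s IH]; [unfold tolerance; simpl; lra |].
  rewrite tolerance_S in IH; pose proof (tolerance_pos (S s)); lra.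
Qed.

Lemma tolerance_decr s t : (s <= t)%nat -> tolerance t <= tolerance s.
Proof.
  intros H; induction H as [| t _ IH]; [lra |].
  rewrite tolerance_S in IH; pose proof (tolerance_pos (S t)); lra.
Qed.

Lemma tolerance_small r : 0 < r -> exists s, tolerance s < r.
Proof.
  intros Hr; destruct (pow_half_small r Hr) as [k Hk]; exists k.
  pose proof (tolerance_pos k) as H; unfold tolerance in *.
  assert (0 < / 2 ^ k) by (apply Rinv_0_lt_compat, pow_lt; lra).
  assert (E : / 2 ^ S k = / 2 * / 2 ^ k).
  { change (2 ^ S k) with (2 * 2 ^ k); rewrite Rinv_mult; reflexivity. }
  lra.
Qed.

(** * Reciprocals of integers and partial sums of squares *)

Lemma inv_INR_pos n : (1 <= n)%nat -> 0 < / INR n.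
Proof. intros Hn; apply Rinv_0_lt_compat, lt_0_INR; lia. Qed.

Lemma inv_INR_inj n m : (1 <= n)%nat -> (1 <= m)%nat -> / INR n = / INR m -> n = m.
Proof.
  intros Hn Hm H; apply INR_eq; rewrite <- (Rinv_inv (INR n)), H.
  apply Rinv_inv.
Qed.

(** The radius is the gap between [1/n] and [1/(n+1)]; the gap to [1/(n-1)] is larger, and 0 is
    further away than [1/(n+1)]. *)
Lemma inv_INR_isolated n u :
  (1 <= n)%nat -> (u = 0 \/ exists m, (1 <= m)%nat /\ u = / INR m) ->
  Rabs (u - / INR n) < / (INR n * (INR n + 1)) -> u = / INR n.
Proof.
  intros Hn Hu Habs.
  assert (Hn1 : 1 <= INR n) by (change 1 with (INR 1); apply le_INR, Hn).
  apply Rabs_def2 in Habs; destruct Habs as [H1 H2].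
  assert (E : / (INR n * (INR n + 1)) = / INR n - / (INR n + 1)) by (field; lra).
  destruct Hu as [-> | [m [Hm ->]]].
  - assert (0 < / (INR n + 1)) by (apply Rinv_0_lt_compat; lra); lra.
  - destruct (Nat.lt_trichotomy m n) as [H | [-> | H]]; [| reflexivity |].
    + assert (Hm1 : 1 <= INR m) by (change 1 with (INR 1); apply le_INR, Hm).
      assert (Hmn : INR m + 1 <= INR n) by (rewrite <- S_INR; apply le_INR; lia).
      assert (Hm2 : / (INR n - 1) <= / INR m) by (apply Rinv_le_contravar; lra).
      assert (Hn2 : / INR n + / (INR n * (INR n + 1)) <= / (INR n - 1)).
      { assert (E2 : / (INR n - 1) - / INR n = / (INR n * (INR n - 1)))
          by (field; lra).
        assert (/ (INR n * (INR n + 1)) <= / (INR n * (INR n - 1)));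
          [apply Rinv_le_contravar; nra | lra]. }
      lra.
    + assert (/ INR m <= / (INR n + 1)); [| lra].
      apply Rinv_le_contravar; [lra |]; rewrite <- S_INR; apply le_INR; lia.
Qed.

Lemma sum_single i c I :
  sum_f_R0 (fun j => if (i =? j)%nat then c else 0) I =
  if (i <=? I)%nat then c else 0.
Proof.
  induction I as [| I IH].
  - destruct i; reflexivity.
  - rewrite tech5, IH.
    destruct (Nat.leb_spec i I), (Nat.eqb_spec i (S I)), (Nat.leb_spec i (S I));
      try lia; lra.
Qed.

Definition sqdist (u w : nat -> R) (I : nat) : R :=
  sum_f_R0 (fun j => (u j - w j) ^ 2) I.

Lemma sqdist_sym u w I : sqdist u w I = sqdist w u I.
Proof. apply sum_eq; intros; ring. Qed.

Lemma sqdist_tri u v w I : sqdist u w I <= 2 * sqdist u v I + 2 * sqdist v w I.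
Proof.
  unfold sqdist; rewrite !scal_sum, <- sum_plus; apply sum_Rle; intros j _.
  pose proof (pow2_ge_0 ((u j - v j) - (v j - w j))); nra.
Qed.

Lemma sum_squares_growing (z : nat -> R) : Un_growing (sum_f_R0 (fun i => z i ^ 2)).
Proof. intros n; rewrite tech5; pose proof (pow2_ge_0 (z (S n))); lra. Qed.

Lemma l2norm_of_bound z b :
  (forall I, sum_f_R0 (fun i => z i ^ 2) I <= b) ->
  exists r, has_l2norm z r /\ r ^ 2 <= b.
Proof.
  intros Hb; set (s := sum_f_R0 (fun i => z i ^ 2)).
  destruct (completeness (EUn s)) as [l Hl].
  - exists b; intros t [n ->]; apply Hb.
  - exists (s 0%nat), 0%nat; reflexivity.
  - assert (Hl0 : 0 <= l).
    { apply Rle_trans with (s 0%nat); [apply pow2_ge_0 | apply Hl; exists 0%nat; auto]. }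
    exists (sqrt l); rewrite pow2_sqrt by exact Hl0; split; [split |].
    + apply sqrt_pos.
    + rewrite pow2_sqrt by exact Hl0.
      apply (Un_cv_crit_lub s); [apply sum_squares_growing | exact Hl].
    + apply Hl; intros t [n ->]; apply Hb.
Qed.

Lemma l2norm_bounds z r I :
  has_l2norm z r -> sum_f_R0 (fun i => z i ^ 2) I <= r ^ 2.
Proof.
  intros [_ H].
  apply (growing_ineq (sum_f_R0 (fun i => z i ^ 2))); [apply sum_squares_growing |].
  exact H.
Qed.

Lemma l2dist_lt_of_bound x y b eps :
  (forall I, sqdist x y I <= b) -> 0 < eps -> b < eps ^ 2 -> l2dist_lt x y eps.
Proof.
  intros H Heps Hb; destruct (l2norm_of_bound (vsub x y) b H) as [r [Hr1 Hr2]].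
  exists r; split; [exact Hr1 | nra].
Qed.

Lemma l2dist_lt_sqdist x y eps I : l2dist_lt x y eps -> sqdist x y I < eps ^ 2.
Proof.
  intros [r [Hr1 Hr2]]; pose proof (l2norm_bounds _ _ I Hr1) as H.
  unfold vsub in H; fold (sqdist x y I) in H.
  destruct Hr1 as [Hr0 _]; nra.
Qed.

Lemma l2dist_lt_coord x y eps j : l2dist_lt x y eps -> Rabs (x j - y j) < eps.
Proof.
  intros H; assert (Heps : 0 < eps) by (destruct H as [r [[Hr _] Hr']]; lra).
  apply (l2dist_lt_sqdist x y eps j) in H.
  assert (Hle : (x j - y j) ^ 2 <= sqdist x y j).
  { unfold sqdist; destruct j as [| j]; [simpl; lra |]; rewrite tech5.
    pose proof (cond_pos_sum (fun i => (x i - y i) ^ 2) j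
      (fun i => pow2_ge_0 _)); lra. }
  rewrite <- (Rabs_pos_eq eps) by lra; apply Rsqr_lt_abs_0.
  unfold Rsqr; nra.
Qed.

Lemma sum_tail_bound (a b : nat -> R) I0 c :
  (forall j, 0 <= a j <= b j) -> (forall j, (j <= I0)%nat -> a j = 0) ->
  (forall I, sum_f_R0 b I <= sum_f_R0 b I0 + c) ->
  forall I, sum_f_R0 a I <= c.
Proof.
  intros Hab Ha Hb I.
  apply Rle_trans with (sum_f_R0 a (I + I0)).
  { apply sum_le_more; [intros n; apply Hab | lia]. }
  assert (H : sum_f_R0 a (I + I0) <= sum_f_R0 b (I + I0) - sum_f_R0 b I0).
  { clear Hb; induction I as [| I IH].
    - simpl Nat.add; rewrite (sum_eq_R0 a) by (intros n Hn; apply Ha, Hn); lra.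
    - simpl Nat.add; rewrite !tech5; specialize (Hab (S (I + I0))); lra. }
  specialize (Hb (I + I0)%nat); lra.
Qed.

(** An entry [(i, n, b)] records the answer [b] to the question whether the
    [i]-th coordinate is [1/n]. *)
Definition entry : Type := (nat * nat * bool)%type.

Fixpoint value (l : list entry) (j : nat) : R :=
  match l with
  | nil => 0
  | (i, n, b) :: l => if (b && (i =? j)%nat)%bool then / INR n else value l j
  end.

(** This excludes a second positive answer at a coordinate and the repetition of a question, so
    recorded answers are never contradicted. *)
Definition askable (l : list entry) (i n : nat) : Prop :=
  value l i = 0 /\ forall b, ~ In (i, n, b) l.

Lemma fresh_coordinate (l : list entry) : exists i, forall n, askable l i n.
Proof.
  assert (H : exists i, forall j, (i <= j)%nat -> forall n, askable l j n).
  { induction l as [| [[k m] b] l [i IH]].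
    - exists 0%nat; intros j _ n; split; [reflexivity | intros b []].
    - exists (Nat.max i (S k)); intros j Hj n.
      destruct (IH j ltac:(lia) n) as [H1 H2]; split.
      + simpl; replace (k =? j)%nat with false; [rewrite Bool.andb_false_r; exact H1 |].
        symmetry; apply Nat.eqb_neq; lia.
      + intros c [Hc | Hc]; [injection Hc as -> _ _; lia | exact (H2 c Hc)]. }
  destruct H as [i Hi]; exists i; intros n; apply Hi; lia.
Qed.

(** * Branches of the tree and the coordinates read off from them *)

Section Tree.

Context {X : Type} (d : X -> X -> R) (B : nat -> X -> Prop) (phi : X -> R).
Hypothesis HB : forall i, is_clopen d (B i).
Hypothesis Hne : exists x : X, True.
Hypothesis phi_pos : forall x, 0 <= phi x.
Hypothesis phi_wlsc : wlsc B phi.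
Hypothesis phi_usc : usc d phi.
Hypothesis phi_unbounded :
  forall C x M, is_clopen d C -> C x -> exists y, C y /\ M < phi y.

(** Stage [Cantor.to_nat (0, Cantor.to_nat (j, c))] decides [B j], and stage
    [Cantor.to_nat (S i, w)] asks whether the [i]-th coordinate is [1/(w+1)];
    so every [B j] has infinitely many stages, and every pair [(i, n)] one. *)
Definition step_spec (l : list entry) (P : X -> Prop)
    (q : nat * nat * (X -> Prop)) : Prop :=
  let n := snd (fst q) in
  (1 <= n)%nat /\ askable l (fst (fst q)) n /\
  split_spec d phi P (tolerance (S (length l))) n (snd q) /\
  match Cantor.of_nat (length l) with
  | (O, w) => let j := fst (Cantor.of_nat w) in
      (n = 1%nat \/ decided B j (snd q)) /\
      decided B j (fun x => P x /\ ~ snd q x)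
  | (S k, w) => askable l k (S w) -> fst q = (k, S w)
  end.

Lemma step_exists l P :
  is_clopen d P -> (exists x, P x) -> exists q, step_spec l P q.
Proof.
  intros HP HPne; pose proof (tolerance_pos (S (length l))) as Ht.
  (* An untouched coordinate serves whenever the stage prescribes no question or its prescribed one
     is not askable. *)
  destruct (fresh_coordinate l) as [i Hi].
  unfold step_spec; destruct (Cantor.of_nat (length l)) as [[| k] w].
  - destruct (split_decide d B phi HB phi_pos phi_wlsc phi_usc phi_unbounded
      P _ (fst (Cantor.of_nat w)) HP HPne Ht) as [n [Q [Hn [HQ1 HQ2]]]].
    exists (i, n, Q); simpl; auto.
  - assert (Hsp : forall n, (1 <= n)%nat ->
        exists Q, split_spec d phi P (tolerance (S (length l))) n Q).
    { intros n Hn; apply (split_weight d B); assumption. }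
    destruct (classic (askable l k (S w))) as [Hk | Hk].
    + destruct (Hsp (S w)) as [Q HQ]; [lia |].
      exists (k, S w, Q); simpl; repeat split; auto; try apply Hk; try apply HQ; lia.
    + destruct (Hsp 1%nat) as [Q HQ]; [lia |].
      exists (i, 1%nat, Q); simpl; split; [lia |]; split; [apply Hi |].
      split; [exact HQ | tauto].
Qed.

Section Steps.

Context (step : list entry -> (X -> Prop) -> nat * nat * (X -> Prop)).
Hypothesis Hstep : forall l P,
  is_clopen d P -> (exists x, P x) -> step_spec l P (step l P).

Fixpoint cell (l : list entry) : X -> Prop :=
  match l with
  | nil => fun _ => True
  | (_, _, b) :: l => fun x => cell l x /\ (b = true <-> snd (step l (cell l)) x)
  end.

Definition coord (l : list entry) : nat := fst (fst (step l (cell l))).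
Definition denom (l : list entry) : nat := snd (fst (step l (cell l))).
Definition yes (l : list entry) : X -> Prop := snd (step l (cell l)).

(** The answers come from an arbitrary strategy [o]: that of a point gives its code, while density
    uses the strategy dictated by a target sequence. *)
Fixpoint path (o : list entry -> bool) (s : nat) : list entry :=
  match s with
  | O => nil
  | S s => let l := path o s in (coord l, denom l, o l) :: l
  end.

Lemma path_length o s : length (path o s) = s.
Proof. induction s; simpl; auto. Qed.

Lemma cell_clopen_nonempty o s :
  is_clopen d (cell (path o s)) /\ exists x, cell (path o s) x.
Proof.
  induction s as [| s [IH1 IH2]].
  - split; [apply clopen_true | destruct Hne as [x _]; exists x; exact I].
  - set (l := path o s) in *.
    destruct (Hstep l (cell l) IH1 IH2) as [_ [_ [[HQ1 [HQ2 [_ [HQ4 HQ5]]]] _]]].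
    change (path o (S s)) with ((coord l, denom l, o l) :: l); simpl cell.
    destruct (o l); split.
    + apply clopen_and; [exact IH1 |].
      apply (clopen_ext d (snd (step l (cell l)))); [intros x; tauto | exact HQ1].
    + destruct HQ4 as [x [Hx _]]; exists x; split; [apply HQ2, Hx | tauto].
    + apply clopen_and; [exact IH1 |].
      apply (clopen_ext d (fun x => ~ snd (step l (cell l)) x)).
      * intros x; split; [| intros H H'; apply H in H'; discriminate].
        intros H; split; [discriminate | tauto].
      * apply clopen_not, HQ1.
    + destruct HQ5 as [x [Hx1 [Hx2 _]]]; exists x; split; [exact Hx1 |].
      split; [discriminate | tauto].
Qed.

Lemma path_step_spec o s :
  step_spec (path o s) (cell (path o s)) (step (path o s) (cell (path o s))).
Proof. destruct (cell_clopen_nonempty o s); auto. Qed.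

Lemma denom_pos o s : (1 <= denom (path o s))%nat.
Proof. apply path_step_spec. Qed.

Lemma path_askable o s :
  askable (path o s) (coord (path o s)) (denom (path o s)).
Proof. apply path_step_spec. Qed.

Lemma value_step o s j :
  value (path o (S s)) j =
  value (path o s) j +
  (if (o (path o s) && (coord (path o s) =? j)%nat)%bool
   then / INR (denom (path o s)) else 0).
Proof.
  simpl value.
  destruct (o (path o s) && (coord (path o s) =? j)%nat)%bool eqn:E; [| lra].
  apply andb_prop in E; destruct E as [_ E]; apply Nat.eqb_eq in E.
  rewrite <- E, (proj1 (path_askable o s)); lra.
Qed.

Lemma value_stable o s t j :
  (s <= t)%nat -> value (path o s) j <> 0 -> value (path o t) j = value (path o s) j.
Proof.
  intros Hst Hs; induction Hst as [| t _ IH]; [reflexivity |].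
  simpl value.
  destruct (o (path o t) && (coord (path o t) =? j)%nat)%bool eqn:E; [| exact IH].
  apply andb_prop in E; destruct E as [_ E]; apply Nat.eqb_eq in E.
  pose proof (proj1 (path_askable o t)) as H0; rewrite E in H0.
  congruence.
Qed.

Lemma value_form o s j :
  value (path o s) j = 0 \/
  exists n, (1 <= n)%nat /\ value (path o s) j = / INR n.
Proof.
  induction s as [| s IH]; [left; reflexivity |]; simpl value.
  destruct (o (path o s) && (coord (path o s) =? j)%nat)%bool; [| exact IH].
  right; exists (denom (path o s)); split; [apply denom_pos | reflexivity].
Qed.

Lemma path_denom_pos o s i n b : In (i, n, b) (path o s) -> (1 <= n)%nat.
Proof.
  induction s as [| s IH]; intros H; [destruct H |].
  destruct H as [H | H]; [injection H as _ <- _; apply denom_pos | auto].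
Qed.

(** A positive answer fixes the coordinate for good. After a negative one the value [1/n] could only
    arise by asking the same question again. *)
Lemma path_answer o s i n b :
  In (i, n, b) (path o s) -> (b = true <-> value (path o s) i = / INR n).
Proof.
  induction s as [| s IH]; intros Hin; [destruct Hin |].
  pose proof (path_denom_pos o (S s) i n b Hin) as Hn.
  pose proof (inv_INR_pos n Hn) as Hn0.
  destruct (path_askable o s) as [Hask1 Hask2].
  destruct Hin as [Heq | Hin].
  - injection Heq as E1 E2 E3; rewrite value_step, E1, E2, E3, Nat.eqb_refl.
    rewrite E1 in Hask1; rewrite Hask1; destruct b; simpl; split; intros H;
      try reflexivity; try discriminate; lra.
  - rewrite (IH Hin); split; intros H.
    + rewrite (value_stable o s (S s)); [exact H | lia | lra].
    + simpl value in H.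
      destruct (o (path o s) && (coord (path o s) =? i)%nat)%bool eqn:E; [| exact H].
      apply andb_prop in E; destruct E as [_ E]; apply Nat.eqb_eq in E.
      apply inv_INR_inj in H; [| apply denom_pos | exact Hn].
      rewrite E, H in Hask2; destruct (Hask2 b Hin).
Qed.

Definition answer (x : X) (l : list entry) : bool :=
  if excluded_middle_informative (yes l x) then true else false.

Definition code (x : X) : nat -> list entry := path (answer x).

Lemma answer_true x l : answer x l = true <-> yes l x.
Proof.
  unfold answer; destruct (excluded_middle_informative (yes l x)); split;
    intros H; try discriminate; tauto.
Qed.

Lemma code_cell x s : cell (code x s) x.
Proof.
  induction s as [| s IH]; [exact I |]; split; [exact IH | apply answer_true].
Qed.

Lemma cell_code o s x : cell (path o s) x -> code x s = path o s.
Proof.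
  induction s as [| s IH]; intros H; [reflexivity |].
  destruct H as [H1 H2]; apply IH in H1; unfold code in *; simpl.
  rewrite H1; f_equal; f_equal.
  apply Bool.eq_iff_eq_true; rewrite answer_true; tauto.
Qed.

Lemma cell_decreasing o s t x :
  (s <= t)%nat -> cell (path o t) x -> cell (path o s) x.
Proof.
  intros Hst; induction Hst as [| t _ IH]; [trivial |]; intros [H _]; auto.
Qed.

(** * Infima of [phi] along the branch of a point *)

Definition low (x : X) (s : nat) : R := infimum phi (cell (code x s)).

Lemma cell_infimum o s : is_inf phi (cell (path o s)) (infimum phi (cell (path o s))).
Proof. apply infimum_is_inf; [exact phi_pos | apply cell_clopen_nonempty]. Qed.

Lemma low_le x s : low x s <= phi x.
Proof. apply (cell_infimum (answer x) s), code_cell. Qed.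

Lemma low_increasing x s t : (s <= t)%nat -> low x s <= low x t.
Proof.
  intros Hst; apply infimum_mono; [exact phi_pos | apply cell_clopen_nonempty |].
  intros y; apply cell_decreasing, Hst.
Qed.

(** The amount by which stage [s] increases the squared norm of the value. *)
Definition gain (x : X) (s : nat) : R :=
  if answer x (code x s) then weight (denom (code x s)) else 0.

Lemma low_step x s :
  gain x s - tolerance (S s) <= low x (S s) - low x s <=
  4 * gain x s + tolerance (S s).
Proof.
  pose proof (path_step_spec (answer x) s) as [_ [_ [[_ [HQ2 [HQ3 [HQ4 HQ5]]]] _]]].
  pose proof (low_increasing x s (S s) ltac:(lia)) as Hmono.
  pose proof (cell_infimum (answer x) (S s)) as [Hi1 Hi2].
  pose proof (tolerance_pos (S s)) as Ht.
  rewrite path_length in HQ3, HQ4, HQ5.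
  change (path (answer x)) with (code x) in *.
  fold (low x (S s)) in Hi1, Hi2; fold (low x s) in HQ3, HQ4, HQ5.
  assert (Hcell : forall y, cell (code x (S s)) y <->
      cell (code x s) y /\ (answer x (code x s) = true <-> yes (code x s) y)).
  { intros y; unfold code; simpl; tauto. }
  unfold gain; destruct (answer x (code x s)).
  - split.
    + apply Rnot_lt_le; intros Hlt.
      destruct (Hi2 (low x s + weight (denom (code x s)) - tolerance (S s)
                     - low x (S s))) as [y [Hy1 Hy2]]; [lra |].
      apply Hcell in Hy1.
      specialize (HQ3 y (proj1 (proj2 Hy1) eq_refl)); unfold denom in *; lra.
    + destruct HQ4 as [y [Hy1 Hy2]].
      assert (Hy : cell (code x (S s)) y).
      { apply Hcell; split; [apply HQ2, Hy1 | unfold yes; tauto]. }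
      specialize (Hi1 y Hy); unfold denom; lra.
  - destruct HQ5 as [y [Hy1 [Hy2 Hy3]]].
    assert (Hy : cell (code x (S s)) y).
    { apply Hcell; split; [exact Hy1 |]; split; [discriminate |].
      unfold yes; tauto. }
    specialize (Hi1 y Hy); lra.
Qed.

(** A stage devoted to [B j] that leaves it undecided has a positive answer of weight 1, which
    raises the infimum by at least one half. Infinitely many such stages would push it above
    [phi x]. *)
Lemma cell_decides x j :
  exists s, forall y, cell (code x s) y -> (B j x <-> B j y).
Proof.
  apply NNPP; intros Hno.
  assert (Hjump : forall t, exists s, (t <= s)%nat /\ low x s + / 2 <= low x (S s)).
  { intros t; set (s := Cantor.to_nat (0%nat, Cantor.to_nat (j, t))).
    exists s; split.
    - pose proof (Cantor.to_nat_non_decreasing 0 (Cantor.to_nat (j, t))).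
      pose proof (Cantor.to_nat_non_decreasing j t); unfold s; lia.
    - apply Rnot_lt_le; intros Hlt; apply Hno; exists (S s); intros y Hy.
      pose proof (low_step x s) as [Hl _].
      pose proof (tolerance_le_half (S s)) as Ht'.
      pose proof (tolerance_S s) as Ht; pose proof (tolerance_le_half s).
      pose proof (code_cell x (S s)) as Hx.
      pose proof (path_step_spec (answer x) s) as [_ [_ [_ Hdec]]].
      change (path (answer x)) with (code x) in *.
      rewrite (path_length (answer x) s : length (code x s) = s) in Hdec.
      unfold s in Hdec at 1; rewrite Cantor.cancel_of_to in Hdec.
      cbv zeta in Hdec; rewrite Cantor.cancel_of_to in Hdec; simpl fst in Hdec.
      destruct Hdec as [Hdec1 Hdec2].
      destruct Hx as [Hx1 Hx2], Hy as [Hy1 Hy2].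
      change (path (answer x)) with (code x) in *.
      unfold gain in Hl; destruct (answer x (code x s)).
      + destruct Hdec1 as [H1 | Hdec1].
        * unfold denom in Hl; rewrite H1, weight_1 in Hl; lra.
        * apply Hdec1; tauto.
      + apply Hdec2; split; try assumption; intros H'.
        * apply Hx2 in H'; discriminate.
        * apply Hy2 in H'; discriminate. }
  assert (Hunb : forall k : nat, exists s, INR k / 2 <= low x s).
  { induction k as [| k [s IH]].
    - exists 0%nat; simpl.
      destruct (cell_infimum (answer x) 0) as [_ H].
      apply Rnot_lt_le; intros Hlt.
      destruct (H (- low x 0)) as [y [_ Hy]]; [lra |].
      specialize (phi_pos y); unfold low, code in *; lra.
    - destruct (Hjump s) as [t [Hst Ht]]; exists (S t).
      pose proof (low_increasing x s t Hst); rewrite S_INR; lra. }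
  destruct (nat_ceiling (phi x * 2)) as [k [Hk _]]; [specialize (phi_pos x); lra |].
  destruct (Hunb k) as [s Hs]; pose proof (low_le x s); lra.
Qed.

Lemma cell_sim x N : exists s, forall y, cell (code x s) y -> sim B N x y.
Proof.
  destruct (uniform_bound
    (fun j s => forall y, cell (code x s) y -> (B j x <-> B j y)) N) as [s Hs].
  - intros j s t Hst H y Hy; apply H, (cell_decreasing _ s t), Hy; exact Hst.
  - intros j _; apply cell_decides.
  - exists s; intros y Hy j Hj; apply Hs; assumption.
Qed.

(** The cells eventually lie in any class of [x], and on a suitable class [phi] exceeds
    [phi x - eps]. *)
Lemma low_converges x eps : 0 < eps -> exists s, phi x - eps <= low x s.
Proof.
  intros Heps; destruct (phi_wlsc x (phi x - eps)) as [N HN]; [lra |].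
  destruct (cell_sim x N) as [s Hs]; exists s.
  apply Rnot_lt_le; intros Hlt.
  destruct (cell_infimum (answer x) s) as [_ H].
  destruct (H (phi x - eps - low x s)) as [y [Hy1 Hy2]]; [lra |].
  specialize (HN y (Hs y Hy1)).
  unfold low, code in *; lra.
Qed.

(** * The embedding *)

(** A coordinate changes at most once, from zero to some [1/n], so it is eventually constant. *)
Lemma alpha_exists :
  exists alpha : X -> nat -> R, forall x j,
    exists s, forall t, (s <= t)%nat -> value (code x t) j = alpha x j.
Proof.
  destruct (functional_choice (fun (p : X * nat) a =>
    exists s, forall t, (s <= t)%nat -> value (code (fst p) t) (snd p) = a))
    as [f Hf].
  - intros [x j]; simpl.
    destruct (classic (exists s, value (code x s) j <> 0)) as [[s Hs] | H].
    + exists (value (code x s) j), s; intros t Ht; apply value_stable; assumption.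
    + exists 0, 0%nat; intros t _; apply NNPP; intros Hn; apply H; exists t; exact Hn.
  - exists (fun x j => f (x, j)); intros x j; exact (Hf (x, j)).
Qed.

Context (alpha : X -> nat -> R).
Hypothesis Halpha : forall x j,
  exists s, forall t, (s <= t)%nat -> value (code x t) j = alpha x j.

Lemma alpha_value x s j : value (code x s) j <> 0 -> alpha x j = value (code x s) j.
Proof.
  intros H; destruct (Halpha x j) as [t Ht].
  rewrite <- (Ht (Nat.max s t)) by lia; apply value_stable; [lia | exact H].
Qed.

Lemma alpha_form x j :
  alpha x j = 0 \/ exists n, (1 <= n)%nat /\ alpha x j = / INR n.
Proof.
  destruct (Halpha x j) as [t Ht]; rewrite <- (Ht t) by lia; apply value_form.
Qed.

Lemma path_incl o s t e : (s <= t)%nat -> In e (path o s) -> In e (path o t).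
Proof.
  intros H Hin; induction H as [| t _ IH]; [exact Hin | right; exact IH].
Qed.

Lemma alpha_answer x s :
  yes (code x s) x <-> alpha x (coord (code x s)) = / INR (denom (code x s)).
Proof.
  destruct (Halpha x (coord (code x s))) as [t Ht].
  rewrite <- (Ht (Nat.max (S s) t)) by lia.
  rewrite <- answer_true; apply path_answer.
  apply (path_incl _ (S s)); [lia | left; reflexivity].
Qed.

Lemma alpha_prefix x I :
  exists s, forall t, (s <= t)%nat -> forall j, (j <= I)%nat ->
    value (code x t) j = alpha x j.
Proof.
  destruct (uniform_bound
    (fun j s => forall t, (s <= t)%nat -> value (code x t) j = alpha x j) (S I))
    as [s Hs].
  - intros j s s' Hss H t Ht; apply H; lia.
  - intros j _; apply Halpha.
  - exists s; intros t Ht j Hj; apply Hs; [lia | exact Ht].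
Qed.

(** The coordinate changed at stage [t] was zero until then, so the squares add without a cross
    term. *)
Lemma sqdist_step x s t I :
  (s <= t)%nat ->
  sqdist (value (code x (S t))) (value (code x s)) I =
  sqdist (value (code x t)) (value (code x s)) I +
  (if (coord (code x t) <=? I)%nat then gain x t else 0).
Proof.
  intros Hst; rewrite <- sum_single; unfold sqdist; rewrite <- sum_plus.
  apply sum_eq; intros j _; unfold code; rewrite value_step.
  unfold gain; change (path (answer x)) with (code x).
  destruct (coord (code x t) =? j)%nat eqn:E;
    [| rewrite Bool.andb_false_r, !Rplus_0_r; reflexivity].
  rewrite Bool.andb_true_r; apply Nat.eqb_eq in E.
  destruct (answer x (code x t)); [| rewrite !Rplus_0_r; reflexivity].
  assert (H0 : value (code x t) j = 0).
  { rewrite <- E; apply (path_askable (answer x) t). }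
  assert (H1 : value (code x s) j = 0).
  { apply NNPP; intros Hn.
    pose proof (value_stable (answer x) s t j Hst Hn) as Heq.
    change (path (answer x)) with (code x) in Heq; congruence. }
  rewrite H0, H1; unfold weight; ring.
Qed.

Lemma gain_pos x s : 0 <= gain x s.
Proof.
  unfold gain; destruct (answer x (code x s)); [| lra].
  left; apply weight_pos, denom_pos.
Qed.

Lemma sqdist_code_le x s t I :
  (s <= t)%nat ->
  sqdist (value (code x t)) (value (code x s)) I <=
  low x t - low x s + tolerance s - tolerance t.
Proof.
  intros Hst; induction Hst as [| t Hst IH].
  - unfold sqdist; rewrite (sum_eq _ (fun _ => 0)); [| intros; ring].
    rewrite sum_eq_R0; [lra | reflexivity].
  - rewrite sqdist_step by exact Hst.
    pose proof (low_step x t) as [H _]; pose proof (tolerance_S t).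
    pose proof (gain_pos x t).
    destruct (coord (code x t) <=? I)%nat; lra.
Qed.

Lemma sqdist_code_ge x s t :
  (s <= t)%nat ->
  exists I0, forall I, (I0 <= I)%nat ->
    low x t - low x s <=
    4 * sqdist (value (code x t)) (value (code x s)) I + tolerance s - tolerance t.
Proof.
  intros Hst; induction Hst as [| t Hst [I0 IH]].
  - exists 0%nat; intros I _; unfold sqdist.
    rewrite (sum_eq _ (fun _ => 0)); [| intros; ring].
    rewrite sum_eq_R0; [lra | reflexivity].
  (* [I] must reach every coordinate asked about between [s] and [t]. *)
  - exists (Nat.max I0 (coord (code x t))); intros I HI.
    rewrite sqdist_step by exact Hst; specialize (IH I ltac:(lia)).
    pose proof (low_step x t) as [_ H]; pose proof (tolerance_S t).
    replace (coord (code x t) <=? I)%nat with true; [lra |].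
    symmetry; apply Nat.leb_le; lia.
Qed.

Lemma sqdist_alpha_le x s I :
  sqdist (alpha x) (value (code x s)) I <= phi x - low x s + tolerance s.
Proof.
  destruct (alpha_prefix x I) as [t Ht].
  pose proof (sqdist_code_le x s (Nat.max s t) I ltac:(lia)) as H.
  pose proof (low_le x (Nat.max s t)); pose proof (tolerance_pos (Nat.max s t)).
  replace (sqdist (alpha x) (value (code x s)) I)
    with (sqdist (value (code x (Nat.max s t))) (value (code x s)) I); [lra |].
  apply sum_eq; intros j Hj; rewrite (Ht (Nat.max s t)) by lia; reflexivity.
Qed.

(** Together with [sqdist_alpha_le] this puts the squared tail between a quarter of
    [phi x - low x s] and the whole of it, up to small errors. *)
Lemma sqdist_alpha_ge x s eta :
  0 < eta ->
  exists I, phi x - low x s <=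
    4 * sqdist (alpha x) (value (code x s)) I + tolerance s + eta.
Proof.
  intros Heta; destruct (low_converges x eta Heta) as [t Ht].
  set (u := Nat.max s t).
  destruct (sqdist_code_ge x s u) as [I HI]; [unfold u; lia |].
  specialize (HI I ltac:(lia)); exists I.
  pose proof (low_increasing x t u ltac:(unfold u; lia)).
  pose proof (tolerance_pos u).
  (* [alpha x] keeps the non-zero coordinates of every stage, so passing to the limit can only
     increase the distance. *)
  assert (Hle : sqdist (value (code x u)) (value (code x s)) I <=
                sqdist (alpha x) (value (code x s)) I); [| lra].
  apply sum_Rle; intros j _.
  destruct (Req_dec (value (code x u) j) 0) as [Hu | Hu].
  - assert (Hs : value (code x s) j = 0).
    { apply NNPP; intros Hn.
      pose proof (value_stable (answer x) s u j ltac:(unfold u; lia) Hn) as Heq.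
      change (path (answer x)) with (code x) in Heq; congruence. }
    rewrite Hu, Hs; nra.
  - rewrite (alpha_value x u j Hu); lra.
Qed.

(** A coordinate equal to [1/n] is isolated, and a coordinate different from
    [1/n] stays different nearby: [alpha] determines the answers continuously. *)
Lemma same_code x s :
  exists theta, 0 < theta /\ forall y,
    (forall j, Rabs (alpha y j - alpha x j) < theta) -> code y s = code x s.
Proof.
  induction s as [| s [theta [Htheta IH]]].
  - exists 1; split; [lra | reflexivity].
  - set (l := code x s) in *.
    assert (Hl : (1 <= denom l)%nat) by apply denom_pos.
    destruct (classic (yes l x)) as [Hx | Hx].
    + exists (Rmin theta (/ (INR (denom l) * (INR (denom l) + 1)))).
      assert (Hd : 1 <= INR (denom l)) by (change 1 with (INR 1); apply le_INR, Hl).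
      split; [apply Rmin_pos; [exact Htheta | apply Rinv_0_lt_compat; nra] |].
      intros y Hy.
      assert (Hys : code y s = l).
      { apply IH; intros j; eapply Rlt_le_trans; [apply Hy | apply Rmin_l]. }
      specialize (Hy (coord l)).
      pose proof (proj1 (alpha_answer x s) Hx) as Hax; fold l in Hax.
      rewrite Hax in Hy.
      assert (Hyx : alpha y (coord l) = / INR (denom l)).
      { apply inv_INR_isolated; [exact Hl | apply alpha_form |].
        eapply Rlt_le_trans; [apply Hy | apply Rmin_r]. }
      unfold code in *; simpl; rewrite Hys; fold l; f_equal; f_equal.
      apply Bool.eq_iff_eq_true; rewrite !answer_true.
      split; intros _; [exact Hx |].
      rewrite <- Hys; apply alpha_answer; unfold code; rewrite Hys; exact Hyx.
    + assert (Hne' : alpha x (coord l) <> / INR (denom l)).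
      { intros H; apply Hx, alpha_answer, H. }
      exists (Rmin theta (Rabs (/ INR (denom l) - alpha x (coord l)))).
      split; [apply Rmin_pos; [exact Htheta | apply Rabs_pos_lt; lra] |].
      intros y Hy.
      assert (Hys : code y s = l).
      { apply IH; intros j; eapply Rlt_le_trans; [apply Hy | apply Rmin_l]. }
      specialize (Hy (coord l)).
      assert (Hyx : alpha y (coord l) <> / INR (denom l)).
      { intros H; rewrite H in Hy; apply (Rlt_irrefl (Rabs (/ INR (denom l)
          - alpha x (coord l)))).
        eapply Rlt_le_trans; [apply Hy | apply Rmin_r]. }
      unfold code in *; simpl; rewrite Hys; fold l; f_equal; f_equal.
      apply Bool.eq_iff_eq_true; rewrite !answer_true.
      split; intros H; [| tauto].
      destruct Hyx; rewrite <- Hys; apply alpha_answer.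
      unfold code; rewrite Hys; exact H.
Qed.

Lemma stage_exists x N e :
  0 < e -> exists s,
    (forall y, cell (code x s) y -> sim B N x y) /\
    phi x - e <= low x s /\ tolerance s <= e.
Proof.
  intros He; destruct (cell_sim x N) as [s1 H1].
  destruct (low_converges x e He) as [s2 H2].
  destruct (tolerance_small e He) as [s3 H3].
  exists (Nat.max s1 (Nat.max s2 s3)); split; [| split].
  - intros y Hy; apply H1; eapply (cell_decreasing (answer x)); [| exact Hy]; lia.
  - eapply Rle_trans; [exact H2 | apply low_increasing; lia].
  - eapply Rle_trans; [| left; exact H3]; apply tolerance_decr; lia.
Qed.

Lemma alpha_in_Ec x : in_Ec (alpha x).
Proof.
  split; [| intros i; apply alpha_form].
  (* At stage 0 the value is the zero sequence, so the tail is all of [alpha x]. *)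
  destruct (l2norm_of_bound (alpha x) (phi x - low x 0 + tolerance 0)) as [r [Hr _]];
    [| exists r; exact Hr].
  intros I; eapply Rle_trans; [| apply (sqdist_alpha_le x 0 I)].
  right; apply sum_eq; intros j _; simpl; ring.
Qed.

Lemma alpha_continuous x eps :
  0 < eps -> is_nbhd d x (fun y => l2dist_lt (alpha y) (alpha x) eps).
Proof.
  intros Heps; set (e := eps ^ 2 / 16).
  assert (He : 0 < e) by (unfold e; nra).
  destruct (stage_exists x 0 e He) as [s [_ [Hlow Htol]]].
  apply (nbhd_imp d x (fun y => cell (code x s) y /\ phi y < phi x + e)).
  - intros y [Hy1 Hy2]; apply cell_code in Hy1.
    (* The squared tails of [y] and [x] are at most [3 * e] and [2 * e], and [sqdist_tri] doubles
       both. *)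
    apply (l2dist_lt_of_bound _ _ (10 * e)); [| exact Heps | unfold e; nra].
    intros I.
    pose proof (sqdist_tri (alpha y) (value (code x s)) (alpha x) I) as Htri.
    rewrite (sqdist_sym (value _)) in Htri.
    pose proof (sqdist_alpha_le x s I); pose proof (sqdist_alpha_le y s I) as Hy.
    unfold low in Hy, Hlow, H; change (path (answer x) s) with (code x s) in Hy1.
    rewrite Hy1 in Hy; lra.
  - apply nbhd_and; [| apply phi_usc; lra].
    exact (proj1 (proj1 (cell_clopen_nonempty (answer x) s)) x (code_cell x s)).
Qed.

(** Closeness of the images forces a common code up to a late stage, hence agreement on the first
    [N] sets; closeness of the tails then bounds [phi y]. *)
Lemma alpha_inverse_continuous x delta N eta :
  0 < eta ->
  (forall y, sim B N x y -> phi y < phi x + eta -> d x y < delta) ->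
  exists theta, 0 < theta /\
    forall y, l2dist_lt (alpha y) (alpha x) theta -> d x y < delta.
Proof.
  intros Heta Hsep; set (e := eta / 32).
  assert (He : 0 < e) by (unfold e; lra).
  destruct (stage_exists x N e He) as [s [Hsim [Hlow Htol]]].
  destruct (same_code x s) as [theta [Htheta Hcode]].
  exists (Rmin theta (Rmin 1 e)).
  assert (Ht0 : 0 < Rmin theta (Rmin 1 e)).
  { apply Rmin_pos; [exact Htheta | apply Rmin_pos; lra]. }
  pose proof (Rmin_l theta (Rmin 1 e)); pose proof (Rmin_r theta (Rmin 1 e)).
  pose proof (Rmin_l 1 e); pose proof (Rmin_r 1 e).
  split; [exact Ht0 | intros y Hy].
  assert (Hyx : code y s = code x s).
  { apply Hcode; intros j; eapply Rlt_le_trans; [apply l2dist_lt_coord, Hy | lra]. }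
  apply Hsep.
  - apply Hsim; rewrite <- Hyx; apply code_cell.
  - destruct (sqdist_alpha_ge y s e He) as [I HI].
    pose proof (l2dist_lt_sqdist _ _ _ I Hy) as Hd.
    pose proof (sqdist_tri (alpha y) (alpha x) (value (code x s)) I).
    pose proof (sqdist_alpha_le x s I) as Hx.
    pose proof (low_le x s).
    assert (Hlyx : low y s = low x s) by (unfold low; rewrite Hyx; reflexivity).
    rewrite Hlyx, Hyx in HI.
    (* A radius at most 1 dominates its square. In total [phi y] is below [phi x + 26 * e], within
       [eta = 32 * e]. *)
    assert (Hsq : (Rmin theta (Rmin 1 e)) ^ 2 <= e) by nra.
    unfold e in *; lra.
Qed.

(** * Density of the image *)

(** The strategy answers truthfully for [z]. If [z j = 1/n], the stage of the pair [(j, n)] asks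
    this question unless it was asked before or the coordinate is already non-zero; in each case the
    coordinate ends up right. *)
Lemma path_toward z :
  (forall i, z i = 0 \/ exists n, (1 <= n)%nat /\ z i = / INR n) ->
  exists o, forall I, exists s, forall t, (s <= t)%nat ->
    (forall j, (j <= I)%nat -> value (path o t) j = z j) /\
    (forall j, value (path o t) j = 0 \/ value (path o t) j = z j).
Proof.
  intros Hz.
  set (o := fun l => if Req_dec_T (z (coord l)) (/ INR (denom l))
                     then true else false).
  assert (Ho : forall l, o l = true <-> z (coord l) = / INR (denom l)).
  { intros l; unfold o; destruct (Req_dec_T (z (coord l)) (/ INR (denom l)));
      split; intros H; try discriminate; tauto. }
  assert (Hval : forall t j, value (path o t) j = 0 \/ value (path o t) j = z j).
  { intros t j; induction t as [| t IH]; [left; reflexivity |]; simpl value.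
    destruct (o (path o t) && (coord (path o t) =? j)%nat)%bool eqn:E; [| exact IH].
    apply andb_prop in E; destruct E as [E1 E2].
    apply Nat.eqb_eq in E2; apply Ho in E1; rewrite E2 in E1; right; congruence. }
  assert (Hin : forall t i n b, In (i, n, b) (path o t) ->
            (b = true <-> z i = / INR n)).
  { intros t i n b; induction t as [| t IH]; intros H; [destruct H |].
    destruct H as [H | H]; [| auto].
    injection H as <- <- <-; apply Ho. }
  assert (Hreach : forall j, exists s, forall t, (s <= t)%nat ->
            value (path o t) j = z j).
  { intros j; destruct (Hz j) as [H0 | [n [Hn Hzn]]].
    - exists 0%nat; intros t _; destruct (Hval t j); congruence.
    - pose proof (inv_INR_pos n Hn) as Hpos.
      set (s := Cantor.to_nat (S j, pred n)).
      assert (Hs : value (path o (S s)) j <> 0).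
      { destruct (Req_dec (value (path o s) j) 0) as [H0 | H0];
          [| rewrite (value_stable o s (S s)); [exact H0 | lia | exact H0]].
        destruct (classic (exists b, In (j, n, b) (path o s))) as [[b Hb] | Hno].
        - apply path_answer in Hb as Hans; apply Hin in Hb.
          rewrite H0 in Hans; exfalso; assert (0 = / INR n); [tauto | lra].
        - pose proof (path_step_spec o s) as [_ [_ [_ Hask]]].
          rewrite path_length in Hask; unfold s in Hask at 1.
          rewrite Cantor.cancel_of_to, Nat.succ_pred in Hask by lia.
          assert (Hq : fst (step (path o s) (cell (path o s))) = (j, n)).
          { apply Hask; split; [exact H0 |].
            intros b Hb; apply Hno; exists b; exact Hb. }
          assert (Hc : coord (path o s) = j) by (unfold coord; rewrite Hq; reflexivity).
          assert (Hd : denom (path o s) = n) by (unfold denom; rewrite Hq; reflexivity).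
          assert (Hyes : o (path o s) = true) by (apply Ho; rewrite Hc, Hd; exact Hzn).
          simpl value; rewrite Hyes, Hc, Hd, Nat.eqb_refl; simpl; lra. }
      exists (S s); intros t Ht.
      destruct (Hval t j) as [H | H]; [| exact H].
      rewrite (value_stable o (S s) t) in H; [tauto | exact Ht | exact Hs]. }
  exists o; intros I.
  destruct (uniform_bound
    (fun j s => forall t, (s <= t)%nat -> value (path o t) j = z j) (S I)) as [s Hs].
  - intros j s s' Hss H t Ht; apply H; lia.
  - intros j _; apply Hreach.
  - exists s; intros t Ht; split; [| apply Hval].
    intros j Hj; apply Hs; [lia | exact Ht].
Qed.

Lemma alpha_dense : dense_in_Ec alpha.
Proof.
  intros z eps [[r Hr] Hz] Heps; set (e := eps ^ 2 / 8).
  assert (He : 0 < e) by (unfold e; nra).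
  destruct (proj2 Hr e He) as [I0 HI0].
  destruct (path_toward z Hz) as [o Ho]; destruct (Ho I0) as [s0 Hs0].
  destruct (tolerance_small e He) as [s1 Hs1].
  set (s := Nat.max s0 s1).
  destruct (Hs0 s ltac:(unfold s; lia)) as [Hv1 Hv2].
  assert (Htol : tolerance s <= e).
  { eapply Rle_trans; [| left; exact Hs1]; apply tolerance_decr; unfold s; lia. }
  assert (Hzv : forall I, sqdist (value (path o s)) z I <= e).
  { apply (sum_tail_bound _ (fun i => z i ^ 2) I0).
    - intros j; split; [apply pow2_ge_0 |].
      destruct (Hv2 j) as [-> | ->]; [right; ring |].
      pose proof (pow2_ge_0 (z j)); lra.
    - intros j Hj; rewrite (Hv1 j Hj); ring.
    - intros I; pose proof (l2norm_bounds z r I Hr).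
      specialize (HI0 I0 (Nat.le_refl I0)); unfold Rdist in HI0.
      apply Rabs_def2 in HI0; lra. }
  (* Cells along any strategy are non-empty; a near-minimum of [phi] in this one has squared tail at
     most [2 * e]. *)
  destruct (cell_infimum o s) as [_ Hinf]; destruct (Hinf e He) as [x [Hx1 Hx2]].
  exists x; apply (l2dist_lt_of_bound _ _ (6 * e)); [| exact Heps | unfold e; nra].
  intros I; specialize (Hzv I).
  pose proof (sqdist_tri (alpha x) (value (path o s)) z I).
  pose proof (sqdist_alpha_le x s I) as Hle; unfold low in Hle.
  rewrite (cell_code o s x Hx1) in Hle; lra.
Qed.

(** * Connectedness together with infinity *)

Lemma alpha_unbounded C x M :
  is_clopen d C -> C x -> exists y, C y /\ l2norm_gt (alpha y) M.
Proof.
  intros HC Cx.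
  destruct (phi_unbounded C x (infimum phi (cell nil) + 4 * M ^ 2 + tolerance 0 + 1)
    HC Cx) as [y [Cy Hy]].
  exists y; split; [exact Cy |].
  destruct (alpha_in_Ec y) as [[r Hr] _]; exists r; split; [exact Hr |].
  destruct (sqdist_alpha_ge y 0 1) as [I HI]; [lra |].
  pose proof (l2norm_bounds _ _ I Hr) as Hrb.
  assert (E : sqdist (alpha y) (value (code y 0)) I =
              sum_f_R0 (fun i => alpha y i ^ 2) I).
  { apply sum_eq; intros j _; simpl; ring. }
  change (low y 0) with (infimum phi (cell nil)) in HI.
  rewrite E in HI; destruct Hr as [Hr0 _].
  apply Rnot_le_lt; intros Hle; nra.
Qed.

(** If the two never met on the image, the preimage of [V] would be clopen and non-empty, so its
    image would be unbounded in norm and enter the neighborhood [U] of infinity. *)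
Lemma alpha_meets_at_infinity U V :
  open_l2inf U -> open_l2inf V ->
  (forall x, U (Some (alpha x)) \/ V (Some (alpha x))) ->
  U None -> (exists x, V (Some (alpha x))) ->
  exists x, U (Some (alpha x)) /\ V (Some (alpha x)).
Proof.
  intros [HU HUinf] [HV _] Hcov HUN [x Hx].
  apply NNPP; intros Hno; destruct (HUinf HUN) as [M HM].
  assert (Hop : forall W, (forall u, in_l2 u -> W (Some u) -> exists eps, 0 < eps /\
              forall v, in_l2 v -> l2dist_lt v u eps -> W (Some v)) ->
            is_open d (fun y => W (Some (alpha y)))).
  { intros W HW y Hy; destruct (HW (alpha y)) as [eps [Heps H]];
      [apply alpha_in_Ec | exact Hy |].
    apply (nbhd_imp d y (fun w => l2dist_lt (alpha w) (alpha y) eps)).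
    - intros w Hw; apply H; [apply alpha_in_Ec | exact Hw].
    - apply alpha_continuous, Heps. }
  destruct (alpha_unbounded (fun y => V (Some (alpha y))) x M) as [y [Hy1 Hy2]].
  - split; [apply Hop, HV |].
    intros y Hy; apply (nbhd_imp d y (fun w => U (Some (alpha w)))).
    + intros w Hw1 Hw2; apply Hno; exists w; auto.
    + apply (Hop U HU); destruct (Hcov y); tauto.
  - exact Hx.
  - apply Hno; exists y; split; [| exact Hy1].
    apply HM; [apply alpha_in_Ec | exact Hy2].
Qed.

Lemma alpha_connected :
  connected_l2inf (fun p => p = None \/ exists x, p = Some (alpha x)).
Proof.
  assert (H : forall U V, open_l2inf U -> open_l2inf V ->
    (forall p, p = None \/ (exists x, p = Some (alpha x)) -> U p \/ V p) ->
    U None ->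
    (exists p, (p = None \/ exists x, p = Some (alpha x)) /\ V p) ->
    exists p, (p = None \/ exists x, p = Some (alpha x)) /\ U p /\ V p).
  { intros U V HU HV Hcov HUN [p [[-> | [x ->]] HVp]].
    - exists None; auto.
    - destruct (alpha_meets_at_infinity U V HU HV) as [y [Hy1 Hy2]].
      + intros y; apply Hcov; right; exists y; reflexivity.
      + exact HUN.
      + exists x; exact HVp.
      + exists (Some (alpha y)); split; [right; exists y; reflexivity | auto]. }
  intros U V HU HV Hcov HUp HVp.
  destruct (Hcov None (or_introl eq_refl)) as [HN | HN].
  - apply H; assumption.
  - destruct (H V U) as [p Hp]; try assumption; [| exists p; tauto].
    intros p Hp; destruct (Hcov p Hp); tauto.
Qed.

End Steps.

End Tree.

Theorem theorem3p1 (X : Type) (d : X -> X -> R)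
  (Hmetric : is_metric d) (Hsep : separable d)
  (Hne : inhabited X) (Hcoh : cohesive d) (Hazd : almost_zero_dimensional d) :
  exists alpha : X -> nat -> R,
    embedding_into_Ec d alpha /\
    dense_in_Ec alpha /\
    connected_l2inf (fun p => p = None \/ exists e, p = Some (alpha e)).
Proof.
  destruct (lelek_function d Hmetric Hsep Hazd Hcoh)
    as [B [phi [HB [phi_pos [phi_wlsc [phi_usc [phi_sep phi_unb]]]]]]].
  assert (Hpt : exists x : X, True) by (destruct Hne as [x]; exists x; exact I).
  destruct (functional_choice (fun (p : list entry * (X -> Prop)) q =>
    is_clopen d (snd p) -> (exists x, snd p x) ->
    step_spec d B phi (fst p) (snd p) q)) as [f Hf].
  { intros [l P].
    destruct (classic (is_clopen d P /\ exists x, P x)) as [[H1 H2] | H].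
    - destruct (step_exists d B phi HB phi_pos phi_wlsc phi_usc phi_unb l P H1 H2)
        as [q Hq]; exists q; auto.
    - exists (0%nat, 0%nat, P); tauto. }
  set (step := fun l P => f (l, P)).
  assert (Hstep : forall l P, is_clopen d P -> (exists x, P x) ->
    step_spec d B phi l P (step l P)) by (intros l P; exact (Hf (l, P))).
  destruct (alpha_exists d B phi Hpt step Hstep) as [alpha Halpha].
  exists alpha; split; [| split].
  - assert (Hinv : forall x eps, 0 < eps -> exists delta, 0 < delta /\
      forall y, l2dist_lt (alpha y) (alpha x) delta -> d x y < eps).
    { intros x eps Heps; destruct (phi_sep x eps Heps) as [N [eta [Heta H]]].
      eapply alpha_inverse_continuous; eassumption. }
    split; [| split; [| split]].
    + intros x; eapply alpha_in_Ec; eassumption.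
    (* Injectivity is continuity of the inverse with [eps] equal to [d x y]. *)
    + intros x y Hxy; apply Hmetric, Rle_antisym; [| apply Hmetric].
      apply Rnot_lt_le; intros Hlt.
      destruct (Hinv x (d x y) Hlt) as [delta [Hdelta H]].
      apply (Rlt_irrefl (d x y)), H; rewrite Hxy.
      apply (l2dist_lt_of_bound _ _ 0); [| exact Hdelta | nra].
      intros I; right; unfold sqdist; apply sum_eq_R0; intros; ring.
    + intros x eps Heps; eapply alpha_continuous; eassumption.
    + exact Hinv.
  - eapply alpha_dense; eassumption.
  - eapply alpha_connected; eassumption.
Qed.
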